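(* Let $\theta\in\mathbb{R}$, let $C(\mathbb{T}^2_\theta)$ be the noncommutative $2$-torus with generating unitaries $U_1,U_2$, and let $\tau$ be its canonical tracial state. For a smooth deformation parameter $k$, let $g$ be the strongly $\sigma$-compatible metric on the canonical calculus of rank two given by $g(\sum_{i,j=1}^2 e_i\otimes e_ja_{ij})=ka_{11}+a_{22}$, and let $\Omega_{12}^k$ be the $(1,2)$ curvature two-form of its Levi-Civita connection. For the parameters $k_1=U_1$ and $k_2=U_2$ one has $$\int_\tau\Omega_{12}^{k_1}=0,\qquad \int_\tau\Omega_{12}^{k_2}=\frac14,$$ respectively.
   Context: The algebra. $A=C(\mathbb{T}^2_\theta)$ is the universal $C^*$-algebra generated by unitaries $U_1,U_2$ with $U_1U_2=e^{2\pi i\theta}U_2U_1$; $\mathcal{A}$ is the dense $*$-subalgebra generated by $U_1,U_2$; $\partial_1,\partial_2$ are the derivations of $\mathcal{A}$ with $\partial_i(U_j)=\delta_{ij}U_i$, $\partial_i(U_j^* )=-\delta_{ij}U_j^*$; $\tau$ is the tracial state with $\tau(U_1^mU_2^n)=0$ unless $m=n=0$. A smooth deformation parameter is an invertible $k\in A$ with $k,k^{-1}\in\mathcal{A}$. General notions. A differential calculus on a complex algebra $\mathcal{A}$ is a differential graded algebra $(\Omega(\mathcal{A}),\wedge,d)$ with $\Omega^0(\mathcal{A})=\mathcal{A}$, generated in degree zero. It is quasi-tame if $\Omega^1(\mathcal{A})$ is a finitely generated projective right module, $\Omega^1(\mathcal{A})\otimes_{\mathcal{A}}\Omega^1(\mathcal{A})=\mathrm{Ker}(\wedge)\oplus\mathcal{F}$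 as right modules with $\mathcal{F}\cong\Omega^2(\mathcal{A})$, and the idempotent $P_{\rm sym}$ with range $\mathrm{Ker}(\wedge)$ and kernel $\mathcal{F}$ is a bimodule map; put $\sigma=2P_{\rm sym}-1$. It is tame if moreover $\mathcal{Z}(\Omega^1(\mathcal{A}))\otimes_{\mathcal{Z}(\mathcal{A})}\mathcal{A}\to\Omega^1(\mathcal{A})$, $\sum e_i\otimes a_i\mapsto\sum e_ia_i$, is an isomorphism ($\mathcal{Z}$ denotes center) and $\sigma(\omega\otimes\eta)=\eta\otimes\omega$ for central $\omega,\eta$. A pseudo-Riemannian metric is a right $\mathcal{A}$-linear $g:\Omega^1(\mathcal{A})\otimes_{\mathcal{A}}\Omega^1(\mathcal{A})\to\mathcal{A}$ with $g\circ\sigma=g$ and $\omega\mapsto g(\omega\otimes\,\cdot\,)$ an isomorphism $\Omega^1(\mathcal{A})\to\mathrm{Hom}_{\mathcal{A}}(\Omega^1(\mathcal{A}),\mathcal{A})$; it is strongly $\sigma$-compatible if its values on pairs of central one-forms commute with each other. A connection is a $\mathbb{C}$-linear $\nabla:\Omega^1(\mathcal{A})\to\Omega^1(\mathcal{A})\otimes_{\mathcal{A}}\Omega^1(\mathcal{A})$ with $\nabla(ea)=\nabla(e)a+e\otimes da$; it is Levi-Civita for $g$ if $\wedge\circ\nabla+d=0$ and $\Pi_g(\nabla)=d\circ g$, where $\Pi_g(\nabla)(\omega\otimes\eta a)=(g\otimes\mathrm{id})\sigma_{23}(\nabla(\omega)\otimes\eta+\nabla(\eta)\otimes\omega)\,a+g(\omega\otimes\eta)\,da$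 for central $\omega,\eta$ and $a\in\mathcal{A}$, $\sigma_{23}=\mathrm{id}\otimes\sigma$. On a tame calculus admitting a bilinear metric, each strongly $\sigma$-compatible metric has a unique Levi-Civita connection (known). Canonical calculus of rank two. Fix a faithful state $\tau_0$ on $A$, let $\mathcal{D}=\partial_1\otimes\gamma_1+\partial_2\otimes\gamma_2$ on $L^2(A,\tau_0)\otimes\mathbb{C}^2$, with $\gamma_i^2=1$, $\gamma_1\gamma_2=-\gamma_2\gamma_1$, and $a\in\mathcal{A}$ acting as $a\otimes1$. The calculus is Connes' calculus $\Omega^k(\mathcal{A})=\Pi(\Omega^k_u(\mathcal{A}))/\Pi(\delta J_0^{k-1})$, where $(\Omega^\bullet_u(\mathcal{A}),\delta)$ is the reduced universal differential graded algebra, $\Pi(a_0\delta a_1\cdots\delta a_k)=a_0[\mathcal{D},a_1]\cdots[\mathcal{D},a_k]$, $J_0^k=\ker\Pi|_{\Omega_u^k(\mathcal{A})}$. It is tame; $\Omega^1(\mathcal{A})$ is the free bimodule with central basis $e_i=1\otimes\gamma_i$, $d(a)=\sum_ie_i\partial_i(a)$, $d(e_i)=0$, $e_i\wedge e_j=-e_j\wedge e_i$, and $\Omega^2(\mathcal{A})$ is free of rank one with basis $e_1\wedge e_2$. It has the bilinear metric $g_0(e_i\otimes e_j)=\delta_{ij}$. Curvature form. With the Christoffel symbols of the Levi-Civita connection $\nabla_g$ defined by $\nabla_g(e_i)=\sum_{j,l}e_j\otimes e_l\Gamma^i_{jl}$, put $$\Omega^k_{12}=e_1\wedge e_2\Big(\sum_{p=1}^2(\Gamma^p_{21}\Gamma^1_{p2}-\Gamma^p_{22}\Gamma^1_{p1})-\partial_2(\Gamma^1_{21})+\partial_1(\Gamma^1_{22})\Big).$$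 For $\theta'=e_1\wedge e_2\,a\in\Omega^2(\mathcal{A})$ with $a\in\mathcal{A}$, put $\int_\tau\theta':=\tau(a)$. *)

(* Defs.v *)
From HB Require Import structures.
From mathcomp Require Import all_boot all_order all_algebra generic_quotient.
From mathcomp Require Import complex.
From mathcomp Require Import all_classical all_reals all_analysis.
Set Implicit Arguments.
Unset Strict Implicit.
Unset Printing Implicit Defensive.
Import Order.TTheory GRing.Theory Num.Theory numFieldNormedType.Exports.
Local Open Scope classical_set_scope.
Local Open Scope complex_scope.
Local Open Scope ring_scope.
Local Open Scope quotient_scope.

(* Throughout, the index set {1, 2} is ['I_2]: [0] stands for 1, [1] for 2. *)

Record bimodule (K : fieldType) (A : algType K) := Bimodule {
  bimod_sort :> lmodType K ;
  lact : A -> bimod_sort -> bimod_sort ;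
  ract : bimod_sort -> A -> bimod_sort ;
  lactDl : forall a b m, lact (a + b) m = lact a m + lact b m ;
  lactDr : forall a m n, lact a (m + n) = lact a m + lact a n ;
  lactM : forall a b m, lact (a * b) m = lact a (lact b m) ;
  lact1 : forall m, lact 1 m = m ;
  lactZ : forall (c : K) m, lact (c *: 1) m = c *: m ;
  ractDl : forall m n a, ract (m + n) a = ract m a + ract n a ;
  ractDr : forall m a b, ract m (a + b) = ract m a + ract m b ;
  ractM : forall m a b, ract m (a * b) = ract (ract m a) b ;
  ract1 : forall m, ract m 1 = m ;
  ractZ : forall (c : K) m, ract m (c *: 1) = c *: m ;
  lractA : forall a m b, ract (lact a m) b = lact a (ract m b) }.

Section Tensor.
Variables (K : fieldType) (A : algType K) (M N : bimodule A).

(* Elements of [tens] are finite sums of elementary tensors, written as lists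
   of pairs, modulo the congruence of the commutative monoid of such lists
   generated by biadditivity and balancedness. *)
Inductive tens_rel : seq (M * N) -> seq (M * N) -> Prop :=
| tens_refl s : tens_rel s s
| tens_sym s t : tens_rel s t -> tens_rel t s
| tens_trans s t u : tens_rel s t -> tens_rel t u -> tens_rel s u
| tens_cat s s' t t' :
    tens_rel s s' -> tens_rel t t' -> tens_rel (s ++ t) (s' ++ t')
| tens_comm s t : tens_rel (s ++ t) (t ++ s)
| tens_0 n : tens_rel [:: (0, n)] [::]
| tens_Dl m m' n : tens_rel [:: (m + m', n)] [:: (m, n); (m', n)]
| tens_Dr m n n' : tens_rel [:: (m, n + n')] [:: (m, n); (m, n')]
| tens_bal m a n : tens_rel [:: (ract m a, n)] [:: (m, lact a n)].

Definition tens_relb (s t : seq (M * N)) : bool := `[< tens_rel s t >].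

Lemma tens_relb_refl : reflexive tens_relb.
Proof. by move=> s; apply/asboolP; apply: tens_refl. Qed.
Lemma tens_relb_sym : symmetric tens_relb.
Proof. by move=> s t; apply/asboolP/asboolP; apply: tens_sym. Qed.
Lemma tens_relb_trans : transitive tens_relb.
Proof.
by move=> t s u /asboolP h /asboolP h'; apply/asboolP; apply: tens_trans h h'.
Qed.

Canonical tens_equiv :=
  EquivRel tens_relb tens_relb_refl tens_relb_sym tens_relb_trans.

Definition tens := {eq_quot tens_equiv}.
HB.instance Definition _ := Choice.on tens.
HB.instance Definition _ := EqQuotient.on tens.

Definition tens_of (s : seq (M * N)) : tens := \pi_tens s.

Lemma tens_ofE s t : tens_rel s t -> tens_of s = tens_of t.
Proof. by move=> h; apply/eqmodP/asboolP. Qed.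

Lemma tens_of_inv s t : tens_of s = tens_of t -> tens_rel s t.
Proof. by move=> /eqmodP /asboolP. Qed.

Lemma tens_repr (x : tens) : tens_of (repr x) = x.
Proof. exact: reprK. Qed.

Definition tadd (x y : tens) := tens_of (repr x ++ repr y).

Lemma taddE s t : tadd (tens_of s) (tens_of t) = tens_of (s ++ t).
Proof.
by apply: tens_ofE; apply: tens_cat; apply: tens_of_inv; rewrite tens_repr.
Qed.

Lemma taddA : associative tadd.
Proof.
move=> x y z; rewrite -[x]tens_repr -[y]tens_repr -[z]tens_repr !taddE.
by rewrite catA.
Qed.

Lemma taddC : commutative tadd.
Proof.
move=> x y; rewrite -[x]tens_repr -[y]tens_repr !taddE.
by apply: tens_ofE; apply: tens_comm.
Qed.

Lemma tadd0 : left_id (tens_of [::]) tadd.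
Proof. by move=> x; rewrite -[x]tens_repr taddE. Qed.

HB.instance Definition _ := GRing.isNmodule.Build tens taddA taddC tadd0.

Lemma tens_of_cat s t : tens_of (s ++ t) = tens_of s + tens_of t.
Proof. by rewrite -taddE. Qed.

Lemma tens_of_nil : tens_of [::] = 0. Proof. by []. Qed.

Lemma tens_of_cons p s : tens_of (p :: s) = tens_of [:: p] + tens_of s.
Proof. by rewrite -tens_of_cat. Qed.

Definition tmk (m : M) (n : N) : tens := tens_of [:: (m, n)].

Lemma tens_ofS p s : tens_of (p :: s) = tmk p.1 p.2 + tens_of s.
Proof. by rewrite tens_of_cons; case: p. Qed.

Lemma tmkDl m m' n : tmk (m + m') n = tmk m n + tmk m' n.
Proof. by rewrite /tmk -tens_of_cat; apply: tens_ofE; apply: tens_Dl. Qed.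
Lemma tmkDr m n n' : tmk m (n + n') = tmk m n + tmk m n'.
Proof. by rewrite /tmk -tens_of_cat; apply: tens_ofE; apply: tens_Dr. Qed.
Lemma tmk0l n : tmk 0 n = 0.
Proof. by rewrite -tens_of_nil; apply: tens_ofE; apply: tens_0. Qed.
Lemma tmk_bal m a n : tmk (ract m a) n = tmk m (lact a n).
Proof. by apply: tens_ofE; apply: tens_bal. Qed.

Lemma tens_ind (P : tens -> Prop) :
  P 0 -> (forall m n x, P x -> P (tmk m n + x)) -> forall x, P x.
Proof.
move=> P0 PS x; rewrite -[x]tens_repr; elim: (repr x) => [|p s IH] //.
by rewrite tens_ofS; apply: PS.
Qed.

(* The additive map induced by [f] when [f] is biadditive and balanced. *)
Definition tens_lift (V : nmodType) (f : M -> N -> V) (x : tens) : V :=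
  \sum_(p <- repr x) f p.1 p.2.

Definition balanced (V : nmodType) (f : M -> N -> V) : Prop :=
  [/\ forall m m' n, f (m + m') n = f m n + f m' n,
      forall m n n', f m (n + n') = f m n + f m n',
      forall n, f 0 n = 0 &
      forall m a n, f (ract m a) n = f m (lact a n)].

Section Lift.
Variables (V : nmodType) (f : M -> N -> V) (hf : balanced f).

Lemma tens_lift_of s : tens_lift f (tens_of s) = \sum_(p <- s) f p.1 p.2.
Proof.
have [fDl fDr f0 fb] := hf.
have sumE s1 s2 : tens_rel s1 s2 ->
  \sum_(p <- s1) f p.1 p.2 = \sum_(p <- s2) f p.1 p.2; last first.
  by apply: sumE; apply: tens_of_inv; rewrite tens_repr.
elim => //=.
- by move=> *; apply: etrans; eassumption.
- by move=> ? ? ? ? _ + _; rewrite !big_cat /= => -> ->.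
- by move=> ? ?; rewrite !big_cat /= addrC.
- by move=> ?; rewrite big_cons !big_nil addr0 f0.
- by move=> *; rewrite !big_cons !big_nil !addr0 fDl.
- by move=> *; rewrite !big_cons !big_nil !addr0 fDr.
- by move=> *; rewrite !big_seq1 fb.
Qed.

Lemma tens_lift_tmk m n : tens_lift f (tmk m n) = f m n.
Proof. by rewrite tens_lift_of big_seq1. Qed.

Lemma tens_liftD x y : tens_lift f (x + y) = tens_lift f x + tens_lift f y.
Proof.
by rewrite -[x]tens_repr -[y]tens_repr -tens_of_cat !tens_lift_of big_cat.
Qed.

Lemma tens_lift0 : tens_lift f 0 = 0.
Proof. by rewrite -tens_of_nil tens_lift_of big_nil. Qed.

End Lift.

Section Map.
Variables (f : M -> M) (g : N -> N).
Hypothesis fD : forall m m', f (m + m') = f m + f m'.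
Hypothesis gD : forall n n', g (n + n') = g n + g n'.
Hypothesis fa : forall m a, f (ract m a) = ract (f m) a.
Hypothesis ga : forall a n, g (lact a n) = lact a (g n).

Definition tmap (x : tens) : tens := tens_lift (fun m n => tmk (f m) (g n)) x.

Lemma tmap_bal : balanced (fun m n => tmk (f m) (g n)).
Proof.
split.
- by move=> *; rewrite fD tmkDl.
- by move=> *; rewrite gD tmkDr.
- move=> n; suff -> : f 0 = 0 by rewrite tmk0l.
  by apply: (addrI (f 0)); rewrite -fD !addr0.
- by move=> *; rewrite fa ga tmk_bal.
Qed.

Lemma tmap_tmk m n : tmap (tmk m n) = tmk (f m) (g n).
Proof. exact: (tens_lift_tmk tmap_bal). Qed.
Lemma tmapD x y : tmap (x + y) = tmap x + tmap y.
Proof. exact: (tens_liftD tmap_bal). Qed.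
Lemma tmap0 : tmap 0 = 0.
Proof. exact: (tens_lift0 tmap_bal). Qed.
End Map.

Lemma ract_scale (c : K) (m : M) a : ract (c *: m) a = c *: ract m a.
Proof.
by rewrite -!ractZ -!ractM -scalerAl -scalerAr mul1r mulr1.
Qed.

Definition topp : tens -> tens := tmap (fun m => - m) id.

Lemma ractN (m : M) a : ract (- m) a = - ract m a.
Proof. by rewrite -scaleN1r ract_scale scaleN1r. Qed.

Lemma toppE m n x : topp (tmk m n + x) = tmk (- m) n + topp x.
Proof.
have h1 (u v : M) : - (u + v) = - u + - v by rewrite opprD.
have h2 (u : M) a : - (ract u a) = ract (- u) a by rewrite ractN.
by rewrite /topp tmapD // tmap_tmk.
Qed.

Lemma taddN : left_inverse 0 topp +%R.
Proof.
apply: tens_ind => [|m n x IH].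
  rewrite addr0 /topp tmap0 // => [*|*]; by rewrite ?opprD ?ractN.
by rewrite toppE addrACA IH addr0 -tmkDl addNr tmk0l.
Qed.

HB.instance Definition _ := GRing.Nmodule_isZmodule.Build tens taddN.

Definition tscale (c : K) : tens -> tens := tmap (fun m => c *: m) id.

Lemma tscaleD c : {morph tscale c : x y / x + y}.
Proof.
by move=> x y; rewrite /tscale tmapD // => *; rewrite ?scalerDr ?ract_scale.
Qed.

Lemma tscale_tmk c m n : tscale c (tmk m n) = tmk (c *: m) n.
Proof. by rewrite /tscale tmap_tmk // => *; rewrite ?scalerDr ?ract_scale. Qed.

Lemma tscale0 c : tscale c 0 = 0.
Proof. by rewrite /tscale tmap0 // => *; rewrite ?scalerDr ?ract_scale. Qed.

Lemma tscaleA a b x : tscale a (tscale b x) = tscale (a * b) x.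
Proof.
elim/tens_ind: x => [|m n x IH]; first by rewrite !tscale0.
by rewrite !tscaleD IH !tscale_tmk scalerA.
Qed.
Lemma tscale1 : left_id 1 tscale.
Proof.
elim/tens_ind => [|m n x IH]; first by rewrite !tscale0.
by rewrite !tscaleD IH !tscale_tmk scale1r.
Qed.
Lemma tscaleDl x : {morph tscale^~ x : a b / a + b}.
Proof.
move=> a b; elim/tens_ind: x => [|m n x IH]; first by rewrite !tscale0 addr0.
by rewrite !tscaleD IH !tscale_tmk scalerDl tmkDl addrACA.
Qed.

HB.instance Definition _ :=
  GRing.Zmodule_isLmodule.Build K tens tscaleA tscale1 tscaleD tscaleDl.

Definition tlact (a : A) : tens -> tens := tmap (lact a) id.
Definition tract (x : tens) (a : A) : tens := tmap id (fun n => ract n a) x.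

Lemma tlactDr a : {morph tlact a : x y / x + y}.
Proof. by move=> x y; rewrite /tlact tmapD // => *; rewrite ?lactDr ?lractA. Qed.
Lemma tlact_tmk a m n : tlact a (tmk m n) = tmk (lact a m) n.
Proof. by rewrite /tlact tmap_tmk // => *; rewrite ?lactDr ?lractA. Qed.
Lemma tlact0 a : tlact a 0 = 0.
Proof. by rewrite /tlact tmap0 // => *; rewrite ?lactDr ?lractA. Qed.
Lemma tractDl x y a : tract (x + y) a = tract x a + tract y a.
Proof. by rewrite /tract tmapD // => *; rewrite ?ractDl ?lractA. Qed.
Lemma tract_tmk m n a : tract (tmk m n) a = tmk m (ract n a).
Proof. by rewrite /tract tmap_tmk // => *; rewrite ?ractDl ?lractA. Qed.
Lemma tract0 a : tract 0 a = 0.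
Proof. by rewrite /tract tmap0 // => *; rewrite ?ractDl ?lractA. Qed.
Lemma tlactDl a b x : tlact (a + b) x = tlact a x + tlact b x.
Proof.
elim/tens_ind: x => [|m n x IH]; first by rewrite !tlact0 addr0.
by rewrite !tlactDr IH !tlact_tmk lactDl tmkDl addrACA.
Qed.
Lemma tlactM a b x : tlact (a * b) x = tlact a (tlact b x).
Proof.
elim/tens_ind: x => [|m n x IH]; first by rewrite !tlact0.
by rewrite !tlactDr IH !tlact_tmk lactM.
Qed.
Lemma tlact1 x : tlact 1 x = x.
Proof.
elim/tens_ind: x => [|m n x IH]; first by rewrite !tlact0.
by rewrite !tlactDr IH !tlact_tmk lact1.
Qed.
Lemma tlactZ (c : K) x : tlact (c *: 1) x = c *: x.
Proof.
elim/tens_ind: x => [|m n x IH]; first by rewrite tlact0 scaler0.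
rewrite !tlactDr IH !tlact_tmk lactZ scalerDr; congr (_ + _).
by rewrite -tscale_tmk.
Qed.
Lemma tractDr x a b : tract x (a + b) = tract x a + tract x b.
Proof.
elim/tens_ind: x => [|m n x IH]; first by rewrite !tract0 addr0.
by rewrite !tractDl IH !tract_tmk ractDr tmkDr addrACA.
Qed.
Lemma tractM x a b : tract x (a * b) = tract (tract x a) b.
Proof.
elim/tens_ind: x => [|m n x IH]; first by rewrite !tract0.
by rewrite !tractDl IH !tract_tmk ractM.
Qed.
Lemma tract1 x : tract x 1 = x.
Proof.
elim/tens_ind: x => [|m n x IH]; first by rewrite !tract0.
by rewrite !tractDl IH !tract_tmk ract1.
Qed.
Lemma tractZ (c : K) x : tract x (c *: 1) = c *: x.
Proof.
elim/tens_ind: x => [|m n x IH]; first by rewrite tract0 scaler0.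
rewrite !tractDl IH !tract_tmk ractZ scalerDr; congr (_ + _).
by rewrite -lactZ -tmk_bal ractZ -tscale_tmk.
Qed.
Lemma tlractA a x b : tract (tlact a x) b = tlact a (tract x b).
Proof.
elim/tens_ind: x => [|m n x IH]; first by rewrite !(tract0, tlact0).
by rewrite !(tractDl, tlactDr) IH !(tract_tmk, tlact_tmk).
Qed.

Definition tensor : bimodule A :=
  Bimodule tlactDl tlactDr tlactM tlact1 tlactZ
           tractDl tractDr tractM tract1 tractZ tlractA.

Definition tmul (m : M) (n : N) : tensor := tmk m n.

End Tensor.

Section TensorMaps.
Variables (K : fieldType) (A : algType K) (M N L : bimodule A).

Definition tassoc (x : tensor (tensor M N) L) : tensor M (tensor N L) :=
  @tens_lift K A (tensor M N) L (tensor M (tensor N L))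
    (fun t l => @tens_lift K A M N (tensor M (tensor N L))
      (fun m n => tmul m (tmul n l)) t) x.

Definition tassocV (x : tensor M (tensor N L)) : tensor (tensor M N) L :=
  @tens_lift K A M (tensor N L) (tensor (tensor M N) L)
    (fun m t => @tens_lift K A N L (tensor (tensor M N) L)
      (fun n l => tmul (tmul m n) l) t) x.

End TensorMaps.

Section ModuleMaps.
Variables (K : fieldType) (A : algType K).

Definition right_linear (M N : bimodule A) (f : M -> N) : Prop :=
  (forall x y, f (x + y) = f x + f y) /\
  (forall x a, f (ract x a) = ract (f x) a).

Definition bimodule_map (M N : bimodule A) (f : M -> N) : Prop :=
  right_linear f /\ forall a x, f (lact a x) = lact a (f x).

Definition right_functional (M : bimodule A) (f : M -> A) : Prop :=
  (forall x y, f (x + y) = f x + f y) /\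
  (forall x a, f (ract x a) = f x * a).

Definition bimod_central (M : bimodule A) (m : M) : Prop :=
  forall a, lact a m = ract m a.

End ModuleMaps.

(* The degree of a product is an explicit index [k] with a proof of
   [m + n = k], which avoids casts along arithmetic identities. *)
Record dga (K : fieldType) := Dga {
  dga_form :> nat -> lmodType K ;
  wprod : forall m n k, (m + n = k)%N -> dga_form m -> dga_form n -> dga_form k ;
  dga_one : dga_form 0 ;
  dga_d : forall n, dga_form n -> dga_form n.+1 ;
  wprodDl : forall m n k (e : (m + n = k)%N) x y z,
    wprod e (x + y) z = wprod e x z + wprod e y z ;
  wprodDr : forall m n k (e : (m + n = k)%N) x y z,
    wprod e x (y + z) = wprod e x y + wprod e x z ;
  wprodZl : forall m n k (e : (m + n = k)%N) (c : K) x y,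
    wprod e (c *: x) y = c *: wprod e x y ;
  wprodZr : forall m n k (e : (m + n = k)%N) (c : K) x y,
    wprod e x (c *: y) = c *: wprod e x y ;
  wprodA : forall m n p mn np k (e1 : (m + n = mn)%N) (e2 : (mn + p = k)%N)
      (e3 : (n + p = np)%N) (e4 : (m + np = k)%N) x y z,
    wprod e2 (wprod e1 x y) z = wprod e4 x (wprod e3 y z) ;
  wprod1l : forall n (e : (0 + n = n)%N) x, wprod e dga_one x = x ;
  wprod1r : forall n (e : (n + 0 = n)%N) x, wprod e x dga_one = x ;
  dga_d_linear : forall n, linear (@dga_d n) ;
  dga_d_d : forall n (x : dga_form n), dga_d (dga_d x) = 0 ;
  dga_d_wprod : forall m n k (e : (m + n = k)%N) (e1 : (m.+1 + n = k.+1)%N)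
      (e2 : (m + n.+1 = k.+1)%N) x y,
    dga_d (wprod e x y)
      = wprod e1 (dga_d x) y + (-1) ^+ m *: wprod e2 x (dga_d y) }.

Section Calculus.
Variables (K : fieldType) (A : algType K).

Definition degree0_morphism (O : dga K) (f : A -> O 0%N) : Prop :=
  [/\ linear f, f 1 = dga_one O &
      forall a b, f (a * b) = wprod (erefl : (0 + 0 = 0)%N) (f a) (f b)].

Fixpoint diff_word (O : dga K) (f : A -> O 0%N) (s : seq A) : O (size s) :=
  match s with
  | [::] => dga_one O
  | a :: s' => wprod (add1n (size s')) (dga_d (f a)) (diff_word f s')
  end.

Record calculus := Calculus {
  calc_dga :> dga K ;
  incl : A -> calc_dga 0%N ;
  incl_morphism : degree0_morphism incl ;
  incl_bij : bijective incl ;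
  (* every form is a finite sum of [a0 da1 ... dan] *)
  calc_generated : forall P : (forall n, calc_dga n -> Prop),
    (forall n x y, P n x -> P n y -> P n (x + y)) ->
    (forall a s,
      P (size s) (wprod (add0n (size s)) (incl a) (diff_word incl s))) ->
    forall n x, P n x }.

Section Forms.
Variables (O : calculus) (n : nat).

Definition flact (a : A) (x : O n) : O n := wprod (add0n n) (incl O a) x.
Definition fract (x : O n) (a : A) : O n := wprod (addn0 n) x (incl O a).

Lemma inclD a b : incl O (a + b) = incl O a + incl O b.
Proof. by have [h _ _] := incl_morphism O; rewrite -[a]scale1r h !scale1r. Qed.
Lemma incl1 : incl O 1 = dga_one O.
Proof. by have [_ h _] := incl_morphism O. Qed.
Lemma incl_scale1 c : incl O (c *: 1) = c *: dga_one O.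
Proof.
have [h h1 _] := incl_morphism O.
have i0 : incl O 0 = 0 by apply: (addrI (incl O 0)); rewrite -inclD !addr0.
by rewrite -[c *: 1]addr0 h i0 addr0 h1.
Qed.
Lemma flactDl a b x : flact (a + b) x = flact a x + flact b x.
Proof. by rewrite /flact inclD wprodDl. Qed.
Lemma flactDr a x y : flact a (x + y) = flact a x + flact a y.
Proof. by rewrite /flact wprodDr. Qed.
Lemma flactM a b x : flact (a * b) x = flact a (flact b x).
Proof.
by have [_ _ h] := incl_morphism O; rewrite /flact h; apply: wprodA.
Qed.
Lemma flact1 x : flact 1 x = x.
Proof. by rewrite /flact incl1 wprod1l. Qed.
Lemma flactZ (c : K) x : flact (c *: 1) x = c *: x.
Proof. by rewrite /flact incl_scale1 wprodZl wprod1l. Qed.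
Lemma fractDl x y a : fract (x + y) a = fract x a + fract y a.
Proof. by rewrite /fract wprodDl. Qed.
Lemma fractDr x a b : fract x (a + b) = fract x a + fract x b.
Proof. by rewrite /fract inclD wprodDr. Qed.
Lemma fractM x a b : fract x (a * b) = fract (fract x a) b.
Proof.
by have [_ _ h] := incl_morphism O; rewrite /fract h; symmetry; apply: wprodA.
Qed.
Lemma fract1 x : fract x 1 = x.
Proof. by rewrite /fract incl1 wprod1r. Qed.
Lemma fractZ (c : K) x : fract x (c *: 1) = c *: x.
Proof. by rewrite /fract incl_scale1 wprodZr wprod1r. Qed.
Lemma flractA a x b : fract (flact a x) b = flact a (fract x b).
Proof. exact: wprodA. Qed.

Definition forms : bimodule A :=
  Bimodule flactDl flactDr flactM flact1 flactZ
           fractDl fractDr fractM fract1 fractZ flractA.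

End Forms.

Definition dga_morphism (O O' : dga K) (f : forall n, O n -> O' n) : Prop :=
  [/\ forall n, linear (f n),
      f 0%N (dga_one O) = dga_one O',
      forall m n k (e : (m + n = k)%N) x y,
        f k (wprod e x y) = wprod e (f m x) (f n y) &
      forall n x, f n.+1 (dga_d x) = dga_d (f n x)].

Definition universal_calculus (O : calculus) : Prop :=
  forall (O' : dga K) (phi : A -> O' 0%N), degree0_morphism phi ->
  exists f : forall n, O n -> O' n,
    [/\ dga_morphism f, forall a, f 0%N (incl O a) = phi a &
        forall f' : (forall n, O n -> O' n),
          dga_morphism f' -> (forall a, f' 0%N (incl O a) = phi a) ->
          forall n x, f' n x = f n x].

Variable O : calculus.
Notation Om1 := (forms O 1).
Notation Om2 := (forms O 2).
Notation TT := (tensor Om1 Om1).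

Definition wedge11 (x y : Om1) : Om2 := wprod (erefl : (1 + 1 = 2)%N) x y.

Definition dfun (a : A) : Om1 := dga_d (incl O a).
Definition dform (x : Om1) : Om2 := dga_d (x : O 1%N).

Definition wedgeT (t : TT) : Om2 := tens_lift wedge11 t.

Definition sigma_of (P : TT -> TT) (t : TT) : TT := 2%:R *: P t - t.

(* [P] is the idempotent P_sym of a tame calculus: its range and its kernel are
   the two summands Ker(wedge) and F of the tensor square, with F isomorphic to
   [Om2], and sigma = 2 P - 1 flips central forms. *)
Definition is_Psym (P : TT -> TT) : Prop :=
  [/\ bimodule_map P,
      forall t, P (P t) = P t,
      forall t, wedgeT t = 0 <-> exists s, t = P s,
      exists phi : Om2 -> TT,
        [/\ right_linear phi, injective phi &
            forall t, P t = 0 <-> exists x, t = phi x] &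
      forall x y : Om1, bimod_central x -> bimod_central y ->
        sigma_of P (tmul x y) = tmul y x].

Definition is_metric (P : TT -> TT) (g : TT -> A) : Prop :=
  [/\ right_functional g,
      forall t, g (sigma_of P t) = g t &
      forall phi : Om1 -> A, right_functional phi ->
        exists! x : Om1, forall y, g (tmul x y) = phi y].

Definition strongly_compatible (g : TT -> A) : Prop :=
  forall x y x' y' : Om1, bimod_central x -> bimod_central y ->
    bimod_central x' -> bimod_central y' ->
    g (tmul x y) * g (tmul x' y') = g (tmul x' y') * g (tmul x y).

Definition is_connection (nabla : Om1 -> TT) : Prop :=
  linear nabla /\
  forall x a, nabla (ract x a) = ract (nabla x) a + tmul x (dfun a).

Definition sigma23 (P : TT -> TT) (x : tensor TT Om1) : tensor TT Om1 :=
  tassocV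
    (tens_lift (fun (y : Om1) (t : TT) => tmul y (sigma_of P t)) (tassoc x)).

(* [A] tensor [Om1] is identified with [Om1] through the left action. *)
Definition metric_tens_id (g : TT -> A) (x : tensor TT Om1) : Om1 :=
  tens_lift (fun (t : TT) (y : Om1) => lact (g t) y) x.

(* [F] is the map Pi_g(nabla); the elements [x] tensor [y a] with [x], [y] central
   span the tensor square of a tame calculus. *)
Definition is_Pi_g (P : TT -> TT) (g : TT -> A) (nabla : Om1 -> TT)
    (F : TT -> Om1) : Prop :=
  (forall s t, F (s + t) = F s + F t) /\
  forall (x y : Om1) (a : A), bimod_central x -> bimod_central y ->
    F (tmul x (ract y a))
      = ract (metric_tens_id g
                (sigma23 P (tmul (nabla x) y + tmul (nabla y) x))) a
        + lact (g (tmul x y)) (dfun a).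

Definition levi_civita (P : TT -> TT) (g : TT -> A) (nabla : Om1 -> TT) : Prop :=
  [/\ is_connection nabla,
      forall x, wedgeT (nabla x) + dform x = 0 &
      is_Pi_g P g nabla (fun t => dfun (g t))].

(* [Gam i j l] is the Christoffel symbol with upper index [i] and lower indices
   [j], [l]. *)
Definition christoffel (e : 'I_2 -> Om1) (nabla : Om1 -> TT)
    (Gam : 'I_2 -> 'I_2 -> 'I_2 -> A) : Prop :=
  forall i, nabla (e i)
    = \sum_(j < 2) \sum_(l < 2) tmul (e j) (ract (e l) (Gam i j l)).

Definition curvature12 (e : 'I_2 -> Om1) (der : 'I_2 -> A -> A)
    (Gam : 'I_2 -> 'I_2 -> 'I_2 -> A) : Om2 :=
  ract (wedge11 (e 0) (e 1))
    (\sum_(p < 2) (Gam p 1 0 * Gam 0 p 1 - Gam p 1 1 * Gam 0 p 0)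
     - der 1 (Gam 0 1 0) + der 0 (Gam 0 1 1)).

(* The coefficient [a] of [e_1 /\ e_2 a]; unique when [e_1 /\ e_2] is a basis. *)
Definition form_integral (e : 'I_2 -> Om1) (tau : A -> K) (x : Om2) : K :=
  tau (xget 0 [set a | x = ract (wedge11 (e 0) (e 1)) a]).

Definition diag_metric (e : 'I_2 -> Om1) (k : A) (g : TT -> A) : Prop :=
  forall a : 'I_2 -> 'I_2 -> A,
    g (\sum_(i < 2) \sum_(j < 2) tmul (e i) (ract (e j) (a i j)))
      = k * a 0 0 + a 1 1.

End Calculus.

(* The norm and its completeness are spelled out, since the library has no
   structure joining algebras and normed modules. *)
HB.mixin Record Algebra_isCStar (R : realType) A of GRing.Algebra R[i] A := {
  star : A -> A ;
  cnorm : A -> R ;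
  starK : forall x, star (star x) = x ;
  starD : forall x y, star (x + y) = star x + star y ;
  starZ : forall (c : R[i]) x, star (c *: x) = Num.conj c *: star x ;
  starM : forall x y, star (x * y) = star y * star x ;
  cnorm_ge0 : forall x, 0 <= cnorm x ;
  cnorm_eq0 : forall x, cnorm x = 0 -> x = 0 ;
  cnormD : forall x y, cnorm (x + y) <= cnorm x + cnorm y ;
  cnormZ : forall (c : R[i]) x, (cnorm (c *: x))%:C = `|c| * (cnorm x)%:C ;
  cnormM : forall x y, cnorm (x * y) <= cnorm x * cnorm y ;
  cstar_identity : forall x, cnorm (star x * x) = cnorm x ^+ 2 ;
  cnorm_complete : forall u : nat -> A,
    (forall eps : R, 0 < eps -> exists N, forall m n,
       (N <= m)%N -> (N <= n)%N -> cnorm (u m - u n) < eps) ->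
    exists l, forall eps : R, 0 < eps -> exists N, forall n,
       (N <= n)%N -> cnorm (u n - l) < eps }.

#[short(type="cstarType")]
HB.structure Definition CStar (R : realType) :=
  {A of GRing.Algebra R[i] A & Algebra_isCStar R A}.

Definition star_subalgebra (R : realType) (A : cstarType R) (S : set A) : Prop :=
  [/\ S 1,
      forall (c : R[i]) x y, S x -> S y -> S (c *: x + y),
      forall x y, S x -> S y -> S (x * y) &
      forall x, S x -> S (star x)].

Definition generated (R : realType) (A : cstarType R) (U : 'I_2 -> A) : set A :=
  [set x | forall S, star_subalgebra S -> (forall i, S (U i)) -> S x].

Definition gen_pred (R : realType) (A : cstarType R) (U : 'I_2 -> A) : {pred A} :=
  fun x => `[< generated U x >].

Lemma gen_subalg (R : realType) (A : cstarType R) (U : 'I_2 -> A) :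
  subalg_closed (@gen_pred R A U).
Proof.
split.
- by apply/asboolP => S [].
- move=> c x y /asboolP hx /asboolP hy; apply/asboolP => S hS hU.
  by have [_ h _ _] := hS; apply: h; [apply: hx|apply: hy].
- move=> x y /asboolP hx /asboolP hy; apply/asboolP => S hS hU.
  by have [_ _ h _] := hS; apply: h; [apply: hx|apply: hy].
Qed.

HB.instance Definition _ (R : realType) (A : cstarType R) (U : 'I_2 -> A) :=
  GRing.isSubalgClosed.Build R[i] A (@gen_pred R A U) (gen_subalg U).

Record torus_alg (R : realType) (A : cstarType R) (U : 'I_2 -> A) :=
  TorusAlg { torus_val :> A ; _ : torus_val \in gen_pred U }.
HB.instance Definition _ (R : realType) (A : cstarType R) (U : 'I_2 -> A) :=
  [isSub for @torus_val R A U].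
HB.instance Definition _ (R : realType) (A : cstarType R) (U : 'I_2 -> A) :=
  [Choice of @torus_alg R A U by <:].
HB.instance Definition _ (R : realType) (A : cstarType R) (U : 'I_2 -> A) :=
  [SubChoice_isSubAlgebra of @torus_alg R A U by <:].

Section Torus.
Variables (R : realType) (theta : R).
Notation C := R[i].

Definition torus_relations (A : cstarType R) (U : 'I_2 -> A) : Prop :=
  (forall i, star (U i) * U i = 1 /\ U i * star (U i) = 1) /\
  U 0 * U 1 = (cos (2 * pi * theta) +i* sin (2 * pi * theta)) *: (U 1 * U 0).

Definition star_morphism (A B : cstarType R) (f : A -> B) : Prop :=
  [/\ linear f, f 1 = 1, forall x y, f (x * y) = f x * f y &
      forall x, f (star x) = star (f x)].

Definition nc_torus (A : cstarType R) (U : 'I_2 -> A) : Prop :=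
  [/\ torus_relations U,
      forall (x : A) (eps : R), 0 < eps ->
        exists2 y, generated U y & cnorm (x - y) < eps &
      forall (B : cstarType R) (V : 'I_2 -> B), torus_relations V ->
        exists f : A -> B,
          [/\ star_morphism f, forall i, f (U i) = V i &
              forall f' : A -> B, star_morphism f' ->
                (forall i, f' (U i) = V i) -> forall x, f' x = f x]].

Variables (A : cstarType R) (U : 'I_2 -> A).
Notation sA := (torus_alg U).

Lemma generated_U i : U i \in gen_pred U.
Proof. by apply/asboolP => S _; apply. Qed.

Lemma generated_Ustar i : star (U i) \in gen_pred U.
Proof. by apply/asboolP => S [_ _ _ hS] hU; apply/hS/hU. Qed.

Definition torus_gen (i : 'I_2) : sA := TorusAlg (generated_U i).
Definition torus_genstar (i : 'I_2) : sA := TorusAlg (generated_Ustar i).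

Record deformation_parameter := DeformationParameter {
  defo_val :> sA ;
  defo_inv : sA ;
  _ : defo_val * defo_inv = 1 ;
  _ : defo_inv * defo_val = 1 }.

Lemma gen_genstar (h : torus_relations U) i : torus_gen i * torus_genstar i = 1.
Proof. by apply: val_inj; have [/(_ i)[]] := h. Qed.

Lemma genstar_gen (h : torus_relations U) i : torus_genstar i * torus_gen i = 1.
Proof. by apply: val_inj; have [/(_ i)[]] := h. Qed.

Definition gen_parameter (h : torus_relations U) (i : 'I_2) :
    deformation_parameter :=
  DeformationParameter (gen_genstar h i) (genstar_gen h i).

Definition canonical_derivations (der : 'I_2 -> sA -> sA) : Prop :=
  [/\ forall i, linear (der i),
      forall i a b, der i (a * b) = der i a * b + a * der i b,
      forall i j, der i (torus_gen j) = (i == j)%:R *: torus_gen i &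
      forall i j, der i (torus_genstar j) = - ((i == j)%:R *: torus_genstar i)].

Definition is_state (t : A -> C) : Prop :=
  [/\ scalar t, forall a, 0 <= t (star a * a), t 1 = 1 &
      forall a, `|t a| <= (cnorm a)%:C].

Definition faithful_state (t : A -> C) : Prop :=
  is_state t /\ forall a, t (star a * a) = 0 -> a = 0.

Definition upow (u : A) (m : int) : A :=
  match m with Posz n => u ^+ n | Negz n => star u ^+ n.+1 end.

Definition canonical_trace (t : A -> C) : Prop :=
  [/\ is_state t, forall a b, t (a * b) = t (b * a) &
      forall m n : int, ~ (m = 0 /\ n = 0) ->
        t (upow (U 0) m * upow (U 1) n) = 0].

(* [H], together with [emb], is the GNS space L^2(A, tau0). *)
Definition is_L2 (tau0 : A -> C) (H : completeNormedModType C) (emb : A -> H) :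
    Prop :=
  [/\ linear emb, dense (range emb) &
      forall a, `|emb a| ^+ 2 = tau0 (star a * a)].

Definition clifford (gam : 'I_2 -> 'M[C]_2) : Prop :=
  (forall i, gam i *m gam i = 1%:M) /\ gam 0 *m gam 1 = - (gam 1 *m gam 0).

(* The complex matrix [m] acting on [sA] tensor C^2, written as columns. *)
Definition mact (m : 'M[C]_2) (xi : 'cV[sA]_2) : 'cV[sA]_2 :=
  map_mx (in_alg sA) m *m xi.

Section Dirac.
Variables (der : 'I_2 -> sA -> sA) (gam : 'I_2 -> 'M[C]_2).
Variables (H : completeNormedModType C) (emb : A -> H).

(* The Dirac operator, with its invariant domain [sA] tensor C^2. *)
Definition dirac_op (xi : 'cV[sA]_2) : 'cV[sA]_2 :=
  \sum_(i < 2) mact (gam i) (map_mx (der i) xi).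

Definition dirac_comm (a : sA) (xi : 'cV[sA]_2) : 'cV[sA]_2 :=
  dirac_op (a *: xi) - a *: dirac_op xi.

(* a0 [D, a1] ... [D, an], with s = [a1, ..., an] *)
Definition dirac_word (a0 : sA) (s : seq sA) (xi : 'cV[sA]_2) : 'cV[sA]_2 :=
  a0 *: foldr dirac_comm xi s.

(* The embedding of [sA] tensor C^2 in L^2(A, tau0) tensor C^2 = H * H. *)
Definition emb2 (xi : 'cV[sA]_2) : H * H :=
  (emb (val (xi 0 0)), emb (val (xi 1 0))).

(* [Pi] is the representation of the universal calculus by bounded operators:
   these are determined by their values on the dense subspace [sA] tensor C^2,
   which is invariant under the Dirac operator and under [sA]. *)
Definition is_Pi (Ou : calculus sA)
    (Pi : forall n, Ou n -> H * H -> H * H) : Prop :=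
  [/\ forall n w, linear (Pi n w) /\ continuous (Pi n w),
      forall n (c : C) w w' v,
        Pi n (c *: w + w') v = c *: Pi n w v + Pi n w' v &
      forall a s xi,
        Pi (size s)
           (wprod (add0n (size s)) (incl Ou a) (diff_word (incl Ou) s))
           (emb2 xi)
          = emb2 (dirac_word a s xi)].

(* [O] is the quotient of the image of [Pi] by that of d J_0: the
   projection [q] kills exactly the [w] with [Pi w] in Pi (d J_0); in degree 0
   the latter space is 0. *)
Definition connes_calculus (Ou : calculus sA)
    (Pi : forall n, Ou n -> H * H -> H * H) (O : calculus sA)
    (q : forall n, Ou n -> O n) : Prop :=
  [/\ dga_morphism q,
      forall a, q 0%N (incl Ou a) = incl O a,
      forall n x, exists w, q n w = x,
      forall w, q 0%N w = 0 <-> (forall v, Pi 0%N w v = 0) &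
      forall n w, q n.+1 w = 0 <->
        exists2 j : Ou n, (forall v, Pi n j v = 0) &
          forall v, Pi n.+1 w v = Pi n.+1 (dga_d j) v].

(* [e i] is the class of the operator 1 tensor gamma_i. *)
Definition canonical_basis (Ou : calculus sA)
    (Pi : forall n, Ou n -> H * H -> H * H) (O : calculus sA)
    (q : forall n, Ou n -> O n) (e : 'I_2 -> forms O 1) : Prop :=
  forall i, exists2 w : Ou 1%N, q 1%N w = e i &
    forall xi, Pi 1%N w (emb2 xi) = emb2 (mact (gam i) xi).

End Dirac.
End Torus.

(* Main.v *)
(* In the central basis [e] metric compatibility and torsion-freeness are linear
   in the Christoffel symbols and, for the metric diag(k, 1), determine them:
   with [f = k^-1 d_2 k / 2], the coefficient of the curvature form on
   [e_1 /\ e_2] is [f^2 - d_2 f].  For [k = U_1] one has [f = 0]; for [k = U_2]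
   one has [f = 1/2].

   The facts about Connes' calculus behind this come from matrices over the
   smooth algebra: [Pi w] is determined by its matrix.  In degree two, a form [j]
   with [Pi j = 0] has [Pi (d j)] scalar because the two derivations commute,
   whereas [gamma_1 gamma_2] has trace zero; hence [e_1 /\ e_2] is free. *)
Require Import Defs.
From HB Require Import structures.
From mathcomp Require Import all_boot all_order all_algebra.
From mathcomp Require Import complex.
From mathcomp Require Import all_classical all_reals all_analysis.
Import Order.TTheory GRing.Theory Num.Theory numFieldNormedType.Exports.
Local Open Scope complex_scope.
Local Open Scope ring_scope.

Set Implicit Arguments.
Unset Strict Implicit.

(** * Two-element index sets and additive maps *)

Lemma ord2_ind (Q : 'I_2 -> Prop) : Q 0 -> Q 1 -> forall i, Q i.
Proof.
move=> Q0 Q1 [[|[|//]] h].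
- by rewrite (_ : Ordinal h = 0) //; apply: val_inj.
- by rewrite (_ : Ordinal h = 1) //; apply: val_inj.
Qed.

Lemma sum_ord2 (V : nmodType) (F : 'I_2 -> V) : \sum_(i < 2) F i = F 0 + F 1.
Proof.
rewrite !big_ord_recl big_ord0 addr0; congr (F _ + F _); exact: val_inj.
Qed.

Lemma additive0 (V W : zmodType) (f : V -> W) :
  (forall x y, f (x + y) = f x + f y) -> f 0 = 0.
Proof. by move=> fD; apply: (addrI (f 0)); rewrite -fD !addr0. Qed.

Lemma additiveN (V W : zmodType) (f : V -> W) :
  (forall x y, f (x + y) = f x + f y) -> forall x, f (- x) = - f x.
Proof.
by move=> fD x; apply: (addrI (f x)); rewrite -fD !subrr (additive0 fD).
Qed.

Arguments ract : simpl never.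
Arguments lact : simpl never.

(** * Tensor products of bimodules *)

Section Bimodules.
Variables (K : fieldType) (A : algType K).

Lemma ract0 (M : bimodule A) (m : M) : ract m 0 = 0.
Proof. exact/additive0/ractDr. Qed.

Lemma lact0r (M : bimodule A) a : lact a (0 : M) = 0.
Proof. exact/additive0/lactDr. Qed.

Lemma ract0l (M : bimodule A) a : ract (0 : M) a = 0.
Proof. by apply: (additive0 (f := fun m : M => ract m a)) => *; rewrite ractDl. Qed.

Lemma ractNr (M : bimodule A) (m : M) a : ract m (- a) = - ract m a.
Proof. by apply: (additiveN (f := ract m)) => *; rewrite ractDr. Qed.

Lemma tmul0r (M N : bimodule A) (m : M) : tmul m (0 : N) = 0.
Proof. by apply: (additive0 (f := tmul m)) => *; apply: tmkDr. Qed.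

(** In a group, [f 0 n = 0] follows from additivity by cancellation. *)
Lemma balancedP (M N : bimodule A) (V : zmodType) (f : M -> N -> V) :
  (forall m m' n, f (m + m') n = f m n + f m' n) ->
  (forall m n n', f m (n + n') = f m n + f m n') ->
  (forall m a n, f (ract m a) n = f m (lact a n)) -> balanced f.
Proof.
move=> fDl fDr fb; split=> // n.
by apply: (additive0 (f := f^~ n)) => *; rewrite fDl.
Qed.

Section Assoc.
Variables (M N L : bimodule A).

(** [tassoc] nests two lifts. Each must be balanced before it can be evaluated on elementary
    tensors: the inner one for fixed [l], then the outer one. *)
Let tassoc_inner_bal l :
  balanced (fun (m : M) (n : N) => tmul m (tmul n l) : tensor M (tensor N L)).
Proof.
apply: balancedP => *; rewrite /tmul ?tmkDl ?tmkDr //.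
by rewrite tmk_bal -tlact_tmk.
Qed.

Let tassoc_bal :
  balanced (fun (t : tensor M N) (l : L) =>
    tens_lift (fun m n => tmul m (tmul n l)) t : tensor M (tensor N L)).
Proof.
apply: balancedP => [s t l|t l l'|t a l].
- exact: tens_liftD.
- elim/tens_ind: t => [|m n t IH]; first by rewrite !tens_lift0 ?addr0.
  rewrite !(tens_liftD (tassoc_inner_bal _)) IH.
  rewrite !(tens_lift_tmk (tassoc_inner_bal _)) addrACA; congr (_ + _).
  by rewrite /tmul !tmkDr.
- elim/tens_ind: t => [|m n t IH].
    by rewrite [ract _ _]tract0 !tens_lift0.
  rewrite [ract _ _]tractDl !(tens_liftD (tassoc_inner_bal _)).
  rewrite [X in _ + X]IH; congr (_ + _).
  rewrite tract_tmk !(tens_lift_tmk (tassoc_inner_bal _)).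
  by rewrite /tmul tmk_bal.
Qed.

Lemma tassocD (x y : tensor (tensor M N) L) :
  tassoc (x + y) = tassoc x + tassoc y.
Proof. exact: (tens_liftD tassoc_bal). Qed.

Lemma tassoc_tmul (m : M) (n : N) (l : L) :
  tassoc (tmul (tmul m n) l) = tmul m (tmul n l).
Proof.
rewrite /tassoc (tens_lift_tmk tassoc_bal).
exact: (tens_lift_tmk (tassoc_inner_bal _)).
Qed.

Let tassocV_inner_bal m :
  balanced (fun (n : N) (l : L) => tmul (tmul m n) l : tensor (tensor M N) L).
Proof.
apply: balancedP => *; rewrite /tmul ?tmkDr ?tmkDl //.
by rewrite -tract_tmk tmk_bal.
Qed.

Let tassocV_bal :
  balanced (fun (m : M) (t : tensor N L) =>
    tens_lift (fun n l => tmul (tmul m n) l) t : tensor (tensor M N) L).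
Proof.
apply: balancedP => [m m' t|m s t|m a t].
- elim/tens_ind: t => [|n l t IH]; first by rewrite !tens_lift0 ?addr0.
  rewrite !(tens_liftD (tassocV_inner_bal _)) IH.
  rewrite !(tens_lift_tmk (tassocV_inner_bal _)) addrACA; congr (_ + _).
  by rewrite /tmul !tmkDl.
- exact: tens_liftD.
- elim/tens_ind: t => [|n l t IH].
    by rewrite [lact _ _]tlact0 !tens_lift0.
  rewrite [lact _ _]tlactDr !(tens_liftD (tassocV_inner_bal _)).
  rewrite [X in _ + X]IH; congr (_ + _).
  rewrite tlact_tmk !(tens_lift_tmk (tassocV_inner_bal _)).
  by rewrite /tmul tmk_bal.
Qed.

Lemma tassocVD (x y : tensor M (tensor N L)) :
  tassocV (x + y) = tassocV x + tassocV y.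
Proof. exact: (tens_liftD tassocV_bal). Qed.

Lemma tassocV_tmul (m : M) (n : N) (l : L) :
  tassocV (tmul m (tmul n l)) = tmul (tmul m n) l.
Proof.
rewrite /tassocV (tens_lift_tmk tassocV_bal).
exact: (tens_lift_tmk (tassocV_inner_bal _)).
Qed.

End Assoc.
End Bimodules.

(** * Levi-Civita connections in a central basis *)

Section LeviCivita.
Variables (K : numFieldType) (A : algType K) (O : calculus A).
Notation Om1 := (forms O 1).
Notation TT := (tensor Om1 Om1).

Lemma dfun1 : dfun O 1 = 0.
Proof.
suff h : dfun O 1 + dfun O 1 = dfun O 1 by apply: (addrI (dfun O 1)); rewrite h addr0.
rewrite {3}/dfun; have [_ i1 iM] := incl_morphism O.
rewrite -[X in Defs.incl O X]mul1r iM dga_d_wprod expr0 scale1r.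
by rewrite i1 wprod1l wprod1r -i1.
Qed.

Lemma wedge11_balanced : balanced (@wedge11 K A O).
Proof.
by apply: balancedP => *; rewrite /wedge11 ?wprodDl ?wprodDr //; exact: wprodA.
Qed.

Lemma wedgeT_tmul x y : wedgeT (tmul x y) = wedge11 x y :> forms O 2.
Proof. exact: (tens_lift_tmk wedge11_balanced). Qed.

Lemma wedgeTD (s t : TT) : wedgeT (s + t) = wedgeT s + wedgeT t.
Proof. exact: (tens_liftD wedge11_balanced). Qed.

Lemma wedge11_ract x y a :
  wedge11 x (ract y a) = ract (wedge11 x y) a :> forms O 2.
Proof. by rewrite /wedge11 /= /fract; symmetry; apply: wprodA. Qed.

Lemma wedge11_lact x y a :
  wedge11 (lact a x) y = lact a (wedge11 x y) :> forms O 2.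
Proof. by rewrite /wedge11 /lact /= /flact; apply: wprodA. Qed.

Variables (P : TT -> TT) (hP : is_Psym P).

Lemma sigma_ofD s t : sigma_of P (s + t) = sigma_of P s + sigma_of P t.
Proof.
have [[[PD _] _] _ _ _ _] := hP.
by rewrite /sigma_of PD scalerDr opprD addrACA.
Qed.

Lemma sigma_of_ract t a : sigma_of P (ract t a) = ract (sigma_of P t) a.
Proof.
have [[[_ PZ] _] _ _ _ _] := hP.
by rewrite /sigma_of PZ ractDl ract_scale ractN.
Qed.

Lemma sigma_of_lact a t : sigma_of P (lact a t) = lact a (sigma_of P t).
Proof.
have [[_ PZ] _ _ _ _] := hP.
have laN u : lact a (- u : TT) = - lact a u.
  by apply: (additiveN (f := lact a)) => *; rewrite lactDr.
rewrite /sigma_of PZ lactDr laN; congr (_ - _).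
(* The factor 2 acts as the central element [2 *: 1], so it commutes with [a]. *)
by rewrite -!lactZ -!lactM -scalerAl -scalerAr mul1r mulr1.
Qed.

(** From [2 P t - t = t] one gets [P t = t], so [t] lies in the range of [P], which is the kernel of
    the wedge. *)
Lemma wedgeT_eq0 t : sigma_of P t = t -> wedgeT t = 0.
Proof.
have [_ _ wP _ _] := hP => /eqP.
rewrite /sigma_of subr_eq -mulr2n -(scaler_nat 2 t) => /eqP.
have n2 : 2%:R != 0 :> K by rewrite pnatr_eq0.
by move=> /(scalerI n2) Pt; apply/wP; exists t; rewrite Pt.
Qed.

(** On central forms sigma is the flip, which fixes the symmetric tensor of [x] and [y]. *)
Lemma wedge11_central x y : bimod_central x -> bimod_central y ->
  wedge11 x y + wedge11 y x = 0 :> forms O 2.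
Proof.
move=> cx cy; have [_ _ _ _ flip] := hP.
rewrite -!wedgeT_tmul -wedgeTD wedgeT_eq0 // sigma_ofD !flip //.
exact: addrC.
Qed.

Lemma wedge11_centralxx x : bimod_central x -> wedge11 x x = 0 :> forms O 2.
Proof.
by move=> cx; have [_ _ _ _ flip] := hP; rewrite -wedgeT_tmul wedgeT_eq0 // flip.
Qed.

Section MetricTensId.
Variables (g : TT -> A) (gl : right_functional g).

Let sigma2_bal :
  balanced (fun (y : Om1) (t : TT) => tmul y (sigma_of P t) : tensor Om1 TT).
Proof.
apply: balancedP => [y y' t|y s t|y a t].
- exact: tmkDl.
- by rewrite sigma_ofD; apply: tmkDr.
- by rewrite sigma_of_lact; apply: tmk_bal.
Qed.

Let metric_bal : balanced (fun (t : TT) (y : Om1) => lact (g t) y).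
Proof.
have [gD gZ] := gl.
apply: balancedP => [s t y|t y y'|t a y].
- by rewrite gD lactDl.
- exact: lactDr.
- by rewrite gZ lactM.
Qed.

Lemma metric_sigma23D x y :
  metric_tens_id g (sigma23 P (x + y))
    = metric_tens_id g (sigma23 P x) + metric_tens_id g (sigma23 P y).
Proof.
rewrite /sigma23 /metric_tens_id tassocD (tens_liftD sigma2_bal) tassocVD.
by rewrite (tens_liftD metric_bal).
Qed.

(** Since [z] is central, [a] moves past it to the right end; sigma then flips [y] and [z], so [g]
    pairs [x] with [z]. *)
Lemma metric_sigma23_tmul x y z a : bimod_central y -> bimod_central z ->
  metric_tens_id g (sigma23 P (tmul (tmul x (ract y a)) z))
    = ract (lact (g (tmul x z)) y) a.
Proof.
move=> cy cz; have [_ _ _ _ flip] := hP.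
rewrite /sigma23 /metric_tens_id tassoc_tmul (tens_lift_tmk sigma2_bal).
have -> : tmul (ract y a) z = ract (tmul y z) a.
  by rewrite /tmul tmk_bal cz [RHS]tract_tmk.
rewrite sigma_of_ract flip // [ract (tmul z y) a]tract_tmk tassocV_tmul.
by rewrite (tens_lift_tmk metric_bal) lractA.
Qed.

End MetricTensId.

(** The Christoffel symbols are computed for any family [e] with the following properties; for the
    canonical basis they are proved from Connes' construction further on. *)
Variables (e : 'I_2 -> Om1) (der : 'I_2 -> A -> A).
Hypothesis e_central : forall i, bimod_central (e i).
Hypothesis e_free : forall a : 'I_2 -> A,
  \sum_(i < 2) ract (e i) (a i) = 0 -> forall i, a i = 0.
Hypothesis e_d : forall i, dform (e i) = 0.
Hypothesis dfunE : forall a, dfun O a = \sum_(i < 2) ract (e i) (der i a).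
Hypothesis e01_free : forall a, ract (wedge11 (e 0) (e 1)) a = 0 -> a = 0.

Variables (k k' : A) (k'k : k' * k = 1).
Variables (g : TT -> A) (nabla : Om1 -> TT).
Variable (Gam : 'I_2 -> 'I_2 -> 'I_2 -> A).
Hypothesis g_metric : is_metric P g.
Hypothesis g_diag : diag_metric e k g.
Hypothesis nabla_lc : levi_civita P g nabla.
Hypothesis nabla_Gam : christoffel e nabla Gam.

Definition diag_coef (i j : 'I_2) : A :=
  if i == j then (if i == 0 then k else 1) else 0.

Lemma diag_metricE i j a : g (tmul (e i) (ract (e j) a)) = diag_coef i j * a.
Proof.
(* The matrix whose only entry is [a], in position [(i, j)], isolates one term of the double sum. *)
have := g_diag (fun p l => if (p == i) && (l == j) then a else 0).
rewrite !sum_ord2.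
move: i j; apply: ord2_ind; apply: ord2_ind; rewrite /diag_coef /=;
  by rewrite !(ract0, tmul0r, addr0, add0r, mulr0, mul0r, mul1r).
Qed.

Lemma diag_metric_tmul i j : g (tmul (e i) (e j)) = diag_coef i j.
Proof. by rewrite -[e j]ract1 diag_metricE mulr1. Qed.

Lemma metric_nabla i j :
  metric_tens_id g (sigma23 P (tmul (nabla (e i)) (e j)))
    = \sum_(l < 2) ract (e l) (\sum_(p < 2) diag_coef p j * Gam i p l).
Proof.
have [gl _ _] := g_metric.
have hD p l : metric_tens_id g
    (sigma23 P (tmul (tmul (e p) (ract (e l) (Gam i p l))) (e j)))
    = ract (e l) (diag_coef p j * Gam i p l).
  by rewrite metric_sigma23_tmul // e_central diag_metric_tmul ractM.
rewrite nabla_Gam !sum_ord2 /tmul !tmkDl !metric_sigma23D // !hD !ractDr.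
exact: addrACA.
Qed.

(** Metric compatibility is evaluated on the tensor of [e i] and [e j] with right coefficient 1,
    where the [d a] term vanishes; freeness then compares the coefficients of [e l]. *)
Lemma compat_christoffel i j l :
  der l (diag_coef i j)
    = \sum_(p < 2) (diag_coef p j * Gam i p l + diag_coef p i * Gam j p l).
Proof.
have [_ _ [_ hPi]] := nabla_lc.
have [gl _ _] := g_metric.
have := hPi (e i) (e j) 1 (e_central i) (e_central j).
rewrite !ract1 dfun1 lact0r addr0 metric_sigma23D //.
rewrite !metric_nabla diag_metric_tmul dfunE.
move=> h; apply/eqP; rewrite -subr_eq0; apply/eqP; move: l.
apply: e_free; rewrite sum_ord2 !big_split /= !(ractDr, ractNr) !opprD.
move: h; rewrite !sum_ord2 => h.
by rewrite -!opprD addrACA h -opprD addrACA subrr.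
Qed.

(** As [d (e i) = 0], torsion-freeness says that the wedge of [nabla (e i)] vanishes. By
    antisymmetry this wedge is the basis two-form times the difference of the two symbols. *)
Lemma christoffel_sym i : Gam i 0 1 = Gam i 1 0.
Proof.
have [_ /(_ (e i)) + _] := nabla_lc.
rewrite e_d addr0 nabla_Gam !sum_ord2 !wedgeTD !wedgeT_tmul !wedge11_ract.
rewrite !wedge11_centralxx // !ract0l addr0 add0r.
have /eqP := wedge11_central (e_central 1) (e_central 0).
rewrite addr_eq0 => /eqP ->; rewrite ractN -ractNr -ractDr => /e01_free /eqP.
by rewrite subr_eq0 => /eqP.
Qed.

(** Compatibility on the index pairs (0,0), (1,1) and (0,1), with the symmetry of the lower indices,
    gives [Gam 0 1 0 = Gam 0 0 1 = f] and [Gam 0 1 1 = Gam 1 1 l = 0]. Only [f * f] and [der 1 f]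
    survive in the curvature. *)
Lemma curvature12E :
  (forall i a b, der i (a + b) = der i a + der i b) ->
  let f := 2%:R^-1 *: (k' * der 1 k) in
  curvature12 e der Gam = ract (wedge11 (e 0) (e 1)) (f * f - der 1 f).
Proof.
move=> derD f.
have half (x y : A) : x + x = y -> x = 2%:R^-1 *: y.
  by move=> <-; rewrite -mulr2n -(scaler_nat 2 x) scalerA mulVf ?scale1r // pnatr_eq0.
have derC l : der l 1 = 0.
  by move: l; apply: e_free; rewrite -dfunE dfun1.
have h00 l : Gam 0 0 l = 2%:R^-1 *: (k' * der l k).
  have := compat_christoffel 0 0 l; rewrite sum_ord2 /diag_coef /=.
  rewrite !mul0r !addr0 => ->; rewrite -mulrDr mulrA k'k mul1r.
  by apply: half.
have h11 l : Gam 1 1 l = 0.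
  have := compat_christoffel 1 1 l; rewrite sum_ord2 /diag_coef /=.
  by rewrite !mul0r !add0r !mul1r derC => /esym/half ->; rewrite scaler0.
have h01 l : Gam 0 1 l + k * Gam 1 0 l = 0.
  have := compat_christoffel 0 1 l; rewrite sum_ord2 /diag_coef /=.
  rewrite !mul0r !mul1r !add0r !addr0 (additive0 (f := der l)) //.
  by rewrite addrC => <-.
have h010 : Gam 0 1 0 = f by rewrite -christoffel_sym h00.
have h011 : Gam 0 1 1 = 0.
  by have := h01 1; rewrite christoffel_sym h11 mulr0 addr0.
rewrite /curvature12 sum_ord2 h011 !h11 h010 h00 !mul0r !subr0 addr0.
by rewrite (additive0 (f := der 0)) // addr0.
Qed.
End LeviCivita.

(** * Matrices over an algebra *)

Section ScalarMatrices.
Variables (F : fieldType) (B : algType F).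
Notation amx := (map_mx (in_alg B)).

Lemma alg_mxM m n p (M : 'M[F]_(m, n)) (N : 'M[F]_(n, p)) :
  amx (M *m N) = amx M *m amx N.
Proof.
apply/matrixP => i j; rewrite !mxE /= scaler_suml; apply: eq_bigr => l _.
by rewrite !mxE /= -scalerAl mul1r scalerA.
Qed.

Lemma alg_mxN m n (M : 'M[F]_(m, n)) : amx (- M) = - amx M.
Proof. by apply/matrixP => i j; rewrite !mxE /= scaleNr. Qed.

Lemma alg_mx1 n : amx (1%:M : 'M[F]_n) = 1%:M.
Proof. by apply/matrixP => i j; rewrite !mxE /= scaler_nat. Qed.

(** The entries of [M] are multiples of 1, hence central in [B]. *)
Lemma alg_mx_scale m n p (M : 'M[F]_(m, n)) b (N : 'M[B]_(n, p)) :
  amx M *m (b *: N) = b *: (amx M *m N).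
Proof.
apply/matrixP => i j; rewrite !mxE mulr_sumr; apply: eq_bigr => l _.
by rewrite !mxE /= !mulr_algl scalerAr.
Qed.

Lemma alg_mx_scalar n (M : 'M[F]_n) (b : B) : amx M *m b%:M = b *: amx M.
Proof. by rewrite -[b%:M]scalemx1 alg_mx_scale mulmx1. Qed.

(** The trace of the relation is [a] times the size of the matrix; divide by that size. *)
Lemma alg_mx_traceless n (M : 'M[F]_n.+1) (a b : B) : (n.+1%:R != 0 :> F) ->
  \tr M = 0 -> a%:M + b *: amx M = 0 -> a = 0.
Proof.
move=> n0 trM /(congr1 (fun X => n.+1%:R^-1 *: \tr X)).
rewrite mxtrace0 scaler0 mxtraceD mxtraceZ mxtrace_scalar.
have -> : \tr (amx M) = (\tr M)%:A.
  by rewrite /mxtrace scaler_suml; apply: eq_bigr => i _; rewrite mxE.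
by rewrite trM scale0r mulr0 addr0 -(scaler_nat n.+1 a) scalerA mulVf // scale1r.
Qed.

End ScalarMatrices.

(** The off-diagonal terms cancel by anticommutation. This will show that the operators divided out
    in degree two are scalar. *)
Lemma clifford_sym (B : pzRingType) n (E : 'I_2 -> 'M[B]_n) (s : 'I_2 -> 'I_2 -> B) :
  (forall i, E i *m E i = 1%:M) -> E 0 *m E 1 = - (E 1 *m E 0) ->
  s 0 1 = s 1 0 ->
  \sum_(i < 2) \sum_(j < 2) s i j *: (E i *m E j) = (s 0 0 + s 1 1)%:M.
Proof.
move=> E2 E01 s01; rewrite !sum_ord2 !E2 E01 s01 scalerN !scalemx1.
by rewrite -addrA (addrA (- _)) addNr add0r -raddfD.
Qed.

(** * Induction on forms, density, and commutators of derivations *)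

Section CalculusInduction.
Variables (K : fieldType) (A : algType K) (O : calculus A).

Lemma form0_incl (w : O 0%N) : exists a, w = Defs.incl O a.
Proof. by have [f _ fK] := incl_bij O; exists (f w); rewrite fK. Qed.

Lemma form1_ind (Q : forms O 1 -> Prop) :
  (forall x y, Q x -> Q y -> Q (x + y)) ->
  (forall a b, Q (lact a (dfun O b))) -> forall x, Q x.
Proof.
move=> QD Qw.
(* Generation is stated for predicates on all degrees at once; [Q'] is trivial outside degree
   one. *)
pose Q' n : O n -> Prop := match n with 1 => Q | _ => fun=> True end.
apply: (calc_generated (P := Q')) => [[|[|n]] //|a [|b [|c s]] //].
rewrite /Q' /= wprod1r; exact: Qw.
Qed.

End CalculusInduction.

(** Points of a Hausdorff space are closed, so the set where [h] differs from [z] is open; if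
    nonempty, it would meet [S]. *)
Lemma continuous_dense0 (T V : topologicalType) (S : set T) (h : T -> V) z :
  hausdorff_space V -> continuous h -> dense S -> (forall x, S x -> h x = z) ->
  forall x, h x = z.
Proof.
move=> hV hc dS h0 x; apply/eqP/negPn/negP => hx.
have op : open (h @^-1` (~` [set z]))%classic.
  apply: open_comp; first by move=> *; apply: hc.
  apply: closed_openC; apply: accessible_closed_set1.
  exact: hausdorff_accessible.
have [|y [/= hy Sy]] := dS _ _ op; first by exists x; apply/eqP.
exact/hy/h0.
Qed.

(** The mixed products [d' a * d b] and [d a * d' b] occur in both iterated derivatives and
    cancel. *)
Lemma derivation_commM (B : pzRingType) (d d' : B -> B) (a b : B) :
  (forall x y, d (x + y) = d x + d y) -> (forall x y, d' (x + y) = d' x + d' y) ->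
  (forall x y, d (x * y) = d x * y + x * d y) ->
  (forall x y, d' (x * y) = d' x * y + x * d' y) ->
  d (d' (a * b)) - d' (d (a * b))
    = (d (d' a) - d' (d a)) * b + a * (d (d' b) - d' (d b)).
Proof.
have sum4 (w x y z w' z' : B) :
    w + x + (y + z) - (w' + y + (x + z')) = w - w' + (z - z').
  rewrite [y + z]addrC [x + z']addrC (addrACA w) (addrACA w') [y + x]addrC.
  by rewrite opprD (addrACA (w + z)) subrr addr0 (opprD w') (addrACA w).
move=> dD dD' dM dM'.
by rewrite dM dM' dD dD' !dM !dM' mulrBl mulrBr sum4.
Qed.

(** * Connes' calculus of the noncommutative torus *)

Section Torus.
Variables (R : realType) (theta : R) (A : cstarType R) (U : 'I_2 -> A).
Notation C := R[i].
Notation sA := (torus_alg U).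
Variables (der : 'I_2 -> sA -> sA) (hder : canonical_derivations der).

Lemma derD i a b : der i (a + b) = der i a + der i b.
Proof. by have [h _ _ _] := hder; rewrite -[a]scale1r h !scale1r. Qed.

Lemma derM i a b : der i (a * b) = der i a * b + a * der i b.
Proof. by have [_ h _ _] := hder. Qed.

Lemma derZ i (c : C) a : der i (c *: a) = c *: der i a.
Proof.
have [h _ _ _] := hder; rewrite -[c *: a]addr0 h.
by rewrite (additive0 (derD i)) addr0.
Qed.

Lemma der1 i : der i 1 = 0.
Proof.
by apply: (addrI (der i 1)); have := derM i 1 1; rewrite !mul1r mulr1 addr0 => <-.
Qed.

Lemma star1 : star (1 : A) = 1.
Proof.
by have := starM (1 : A) (star 1); rewrite mul1r starK mul1r => <-.
Qed.

(** The commutator is a derivation. The generators and their adjoints are eigenvectors of both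
    [der i] and [der j], so it kills them, and hence all they generate. *)
Lemma der_comm i j a : der i (der j a) = der j (der i a).
Proof.
pose com b := der i (der j b) - der j (der i b).
have comD b c : com (b + c) = com b + com c.
  by rewrite /com !derD opprD addrACA.
have comM b c : com (b * c) = com b * c + b * com c.
  by apply: (derivation_commM b c (derD i) (derD j) (derM i) (derM j)).
have comZ (c : C) b : com (c *: b) = c *: com b.
  by rewrite /com !derZ -scalerBr.
pose S : set A := fun x => exists2 b : sA, val b = x & com b = 0.
have S1 : S 1.
  exists 1 => //; apply: (addrI (com 1)).
  by have := comM 1 1; rewrite !mul1r mulr1 addr0 => <-.
have SZD (c : C) x y : S x -> S y -> S (c *: x + y).
  case=> b <- b0 [b' <- b'0]; exists (c *: b + b') => //.
  by rewrite comD comZ b0 b'0 scaler0 addr0.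
have SM x y : S x -> S y -> S (x * y).
  case=> b <- b0 [b' <- b'0]; exists (b * b') => //.
  by rewrite comM b0 b'0 mul0r mulr0 addr0.
have SU l : S (U l) /\ S (star (U l)).
  have [_ _ dU dUs] := hder.
  have dU' p : der p (torus_gen U l) = (p == l)%:R *: torus_gen U l.
    by rewrite dU; case: eqP => [->|] //; rewrite !scale0r.
  have dUs' p : der p (torus_genstar U l) = - (p == l)%:R *: torus_genstar U l.
    by rewrite dUs scaleNr; case: eqP => [->|] //; rewrite !scale0r.
  split; [exists (torus_gen U l) => //|exists (torus_genstar U l) => //].
    by rewrite /com !dU' !derZ !dU' !scalerA mulrC subrr.
  by rewrite /com !dUs' !derZ !dUs' !scalerA mulrC subrr.
(* Derivations need not commute with [star], so [x] and [star x] go together. *)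
have SS : star_subalgebra (fun x => S x /\ S (star x)).
  split.
  - by rewrite star1.
  - by move=> c x y [? ?] [? ?]; rewrite starD starZ; split; apply: SZD.
  - by move=> x y [? ?] [? ?]; rewrite starM; split; apply: SM.
  - by move=> x [? ?]; rewrite starK.
have [[b ba b0] _] : S (val a) /\ S (star (val a)).
  move: (valP a) => /asboolP/(_ _ SS); apply => l.
  exact: SU.
have <- : b = a by apply: val_inj.
by apply/eqP; rewrite -subr_eq0 -/(com b) b0.
Qed.

(** * The smooth algebra inside the GNS space *)

Hypothesis hU : nc_torus theta U.
Variables (tau0 : A -> C) (htau0 : faithful_state tau0).
Variables (H : completeNormedModType C) (emb : A -> H) (hH : is_L2 tau0 emb).
Variables (gam : 'I_2 -> 'M[C]_2) (hgam : clifford gam).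

Notation G i := (map_mx (in_alg sA) (gam i)).

Lemma embD a b : emb (a + b) = emb a + emb b.
Proof. by have [h _ _] := hH; rewrite -[a]scale1r h !scale1r. Qed.

Lemma emb_eq0 a : emb a = 0 -> a = 0.
Proof.
have [_ _ h] := hH; have [_ f] := htau0 => a0; apply: f.
by rewrite -h a0 normr0 expr0n.
Qed.

Lemma emb2D xi zeta : emb2 emb (xi + zeta : 'cV[sA]_2) = emb2 emb xi + emb2 emb zeta.
Proof.
have e p : emb (val ((xi + zeta) p 0)) = emb (val (xi p 0)) + emb (val (zeta p 0)).
  by rewrite mxE -embD.
by rewrite /emb2 !e.
Qed.

Lemma emb2_inj (xi zeta : 'cV[sA]_2) : emb2 emb xi = emb2 emb zeta -> xi = zeta.
Proof.
move=> h; have inj a b : emb (val a) = emb (val b) -> a = b :> sA.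
  move=> hab; apply: val_inj; apply/eqP; rewrite -subr_eq0; apply/eqP.
  by apply: emb_eq0; rewrite embD (additiveN embD) hab subrr.
case: h => /inj h0 /inj h1; apply/matrixP => i j; rewrite (ord1 j).
by move: i; apply: ord2_ind.
Qed.

(** The squared norm is [tau0 (star a * a)]; a state is contractive, and the C*-identity turns the
    bound into [cnorm a ^+ 2]. *)
Lemma norm_emb_le a : `|emb a| <= (cnorm a)%:C.
Proof.
have [_ _ h] := hH; have [[_ tge0 _ tle] _] := htau0.
have c0 : 0 <= (cnorm a)%:C by rewrite lecR cnorm_ge0.
rewrite -(ler_pXn2r (n := 2)) ?nnegrE ?normr_ge0 // h.
apply: le_trans (real_ler_norm (ger0_real (tge0 a))) _.
by apply: le_trans (tle _) _; rewrite cstar_identity rmorphXn.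
Qed.

(** The smooth algebra is norm-dense in [A], the image of [A] is dense in [H], and [emb] is a
    contraction. *)
Lemma emb_gen_dense : dense [set emb (val a) | a in [set: sA]]%classic.
Proof.
have [_ dA _] := hH; have [_ dsA _] := hU.
move=> V V0 oV; have [z [Vz [a _ az]]] := dA V V0 oV.
have /nbhs_ballP[r /= r0 rV] : nbhs (emb a) V by rewrite az; exact: open_nbhs_nbhs.
(* Radii in [H] are positive elements of [R[i]], while [cnorm] takes values in [R]. *)
have rE : (complex.Re r)%:C%C = r by apply: RRe_real; apply: gtr0_real.
have [|y hy ay] := dsA a (complex.Re r).
  by rewrite -ltcR rE.
exists (emb y); split; last first.
  by have yP : y \in gen_pred U by [apply/asboolP]; exists (TorusAlg yP).
apply: rV; rewrite -ball_normE /ball_ /=.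
rewrite -(additiveN embD) -embD; apply: le_lt_trans (norm_emb_le _) _.
by rewrite -rE ltcR.
Qed.

(** By linearity it suffices to treat [(x, 0)] and [(0, y)], and in each of them density in a single
    variable is enough. *)
Lemma emb2_dense (f : (H * H)%type -> (H * H)%type) :
  linear f -> continuous f -> (forall xi : 'cV[sA]_2, f (emb2 emb xi) = 0) ->
  forall v, f v = 0.
Proof.
move=> fl fc f0 [x y].
have fD u v : f (u + v) = f u + f v by rewrite -[u]scale1r fl !scale1r.
have emb0 := additive0 embD.
have -> : (x, y) = (x, 0) + (0, y) :> (H * H)%type.
  by congr (_, _); rewrite /= ?addr0 ?add0r.
rewrite fD.
have hs : hausdorff_space (H * H)%type by apply: norm_hausdorff.
have -> : f (x, 0) = 0.
  apply: (continuous_dense0 (h := fun x => f (x, 0)) hs _ emb_gen_dense).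
    move=> z; apply: continuous_comp; last exact: fc.
    by apply: cvg_pair => /=; [exact: cvg_id | exact: cvg_cst].
  move=> _ [a _ <-]; rewrite -[RHS](f0 (\col_i if i == 0 then a else 0)).
  by rewrite /emb2 !mxE /= emb0.
rewrite add0r.
apply: (continuous_dense0 (h := fun y => f (0, y)) hs _ emb_gen_dense).
  move=> z; apply: continuous_comp; last exact: fc.
  by apply: cvg_pair => /=; [exact: cvg_cst | exact: cvg_id].
move=> _ [a _ <-]; rewrite -[RHS](f0 (\col_i if i == 0 then 0 else a)).
by rewrite /emb2 !mxE /= emb0.
Qed.

(** * Commutators with the Dirac operator and Clifford matrices *)

Definition gamma_comm (a : sA) : 'M[sA]_2 := \sum_(i < 2) der i a *: G i.

(** The Leibniz terms that differentiate [xi] cancel in the commutator, which leaves a matrix. *)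
Lemma dirac_commE a xi : dirac_comm der gam a xi = gamma_comm a *m xi.
Proof.
rewrite /dirac_comm /dirac_op /gamma_comm scaler_sumr -sumrB mulmx_suml.
apply: eq_bigr => i _; rewrite /mact.
have -> : map_mx (der i) (a *: xi) = der i a *: xi + a *: map_mx (der i) xi.
  by apply/matrixP => p l; rewrite !mxE derM.
by rewrite mulmxDr !alg_mx_scale addrK scalemxAl.
Qed.

Lemma alg_clifford_sq i : G i *m G i = 1%:M.
Proof. by have [h _] := hgam; rewrite -alg_mxM h alg_mx1. Qed.

Lemma alg_clifford_anti : G 0 *m G 1 = - (G 1 *m G 0).
Proof. by have [_ h] := hgam; rewrite -!alg_mxM h alg_mxN. Qed.

(** Anticommutation and cyclicity make the trace of [gam 0 *m gam 1] its own negative, so it is zero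
    and [a = 0]; multiplying by the inverse [G 1 *m G 0] then gives [b = 0]. *)
Lemma clifford_scalar_free (a b : sA) : a%:M + b *: (G 0 *m G 1) = 0 -> a = 0 /\ b = 0.
Proof.
have [_ h] := hgam => ab0.
have a0 : a = 0.
  apply: (@alg_mx_traceless _ sA 1 (gam 0 *m gam 1) a b).
  - by rewrite pnatr_eq0.
  - have : \tr (gam 0 *m gam 1) = - \tr (gam 0 *m gam 1).
      by rewrite {1}h raddfN /= mxtrace_mulC.
    move/eqP; rewrite -addr_eq0 -mulr2n mulrn_eq0 => /eqP; exact.
  - by rewrite alg_mxM.
split => //; move: ab0; rewrite a0 raddf0 add0r.
move/(congr1 (fun X => X *m G 1 *m G 0 )).
rewrite !mul0mx -!scalemxAl -!mulmxA (mulmxA (G 1)) alg_clifford_sq mul1mx.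
rewrite alg_clifford_sq => /matrixP/(_ 0 0); by rewrite !mxE mulr1.
Qed.

Lemma clifford_free (c : 'I_2 -> sA) : \sum_(i < 2) c i *: G i = 0 -> forall i, c i = 0.
Proof.
rewrite sum_ord2 => c0.
have /clifford_scalar_free[c00 c10] : (c 0)%:M + (- c 1) *: (G 0 *m G 1) = 0.
  (* Right multiplication by [G 0] turns the relation into one between 1 and [G 0 *m G 1]. *)
  move: c0 => /(congr1 (fun X => X *m G 0)).
  rewrite mul0mx mulmxDl -!scalemxAl alg_clifford_sq scalemx1 scaleNr -scalerN.
  by rewrite alg_clifford_anti opprK.
by apply: ord2_ind => //; rewrite -[c 1]opprK c10 oppr0.
Qed.

(** * The universal calculus represented by matrices *)

Variables (Ou : calculus sA) (Pi : forall n, Ou n -> (H * H)%type -> (H * H)%type).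
Hypothesis hPi : is_Pi der gam emb Pi.

(* [M] is the matrix of the operator [Pi w] on the dense subspace of [H * H]. *)
Definition repr_mx n (w : forms Ou n) (M : 'M[sA]_2) : Prop :=
  forall xi : 'cV[sA]_2, Pi w (emb2 emb xi) = emb2 emb (M *m xi).

Lemma repr_mx_uniq n (w : forms Ou n) M N : repr_mx w M -> repr_mx w N -> M = N.
Proof.
move=> hM hN; apply/matrixP => i j.
have := emb2_inj (etrans (esym (hM (delta_mx j 0))) (hN (delta_mx j 0))).
by rewrite -!colE => /matrixP/(_ i 0); rewrite !mxE.
Qed.

Lemma repr_mxD n (w w' : forms Ou n) M N :
  repr_mx w M -> repr_mx w' N -> repr_mx (w + w') (M + N).
Proof.
have [_ h _] := hPi => hM hN xi.
by rewrite -[w]scale1r h scale1r hM hN mulmxDl emb2D.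
Qed.

Lemma repr_mxB n (w w' : forms Ou n) M N :
  repr_mx w M -> repr_mx w' N -> repr_mx (w - w') (M - N).
Proof.
have [_ h _] := hPi => hM hN xi.
rewrite addrC -scaleN1r h scaleN1r hM hN addrC mulmxBl.
by rewrite (emb2D (M *m xi)) (additiveN emb2D).
Qed.

Lemma repr_mx_word2 a b c :
  repr_mx (wprod (add0n 2) (Defs.incl Ou a) (wprod (add1n 1) (dfun Ou b) (dfun Ou c)))
    (a *: (gamma_comm b *m gamma_comm c)).
Proof.
have [_ _ h] := hPi => xi; have := h a [:: b; c] xi.
by rewrite /= wprod1r /dirac_word /= !dirac_commE mulmxA scalemxAl.
Qed.

Lemma repr_mx_word1 a b : repr_mx (lact a (dfun Ou b)) (a *: gamma_comm b).
Proof.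
have [_ _ h] := hPi => xi; have := h a [:: b] xi.
by rewrite /= wprod1r /dirac_word /= dirac_commE scalemxAl.
Qed.

Lemma repr_mx0 a : repr_mx (Defs.incl Ou a : forms Ou 0) a%:M.
Proof.
have [_ _ h] := hPi => xi; have := h a [::] xi.
by rewrite /= wprod1r /dirac_word /= mul_scalar_mx.
Qed.

Lemma gamma_commM a b : gamma_comm (a * b) = gamma_comm a *m b%:M + a *: gamma_comm b.
Proof.
rewrite /gamma_comm mulmx_suml scaler_sumr -big_split; apply: eq_bigr => i _ /=.
by rewrite derM scalerDl scalerA -scalemxAl alg_mx_scalar scalerA.
Qed.

Lemma dfunM a b : dfun Ou (a * b) = ract (dfun Ou a) b + lact a (dfun Ou b).
Proof.
have [_ _ iM] := incl_morphism Ou.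
by rewrite /dfun iM (dga_d_wprod _ (addn0 1) (add0n 1)) expr0 scale1r.
Qed.

(** Replacing [(d b) c] by [d (b * c) - b d c] brings a product of one-forms to the words on which
    [is_Pi] prescribes [Pi]. *)
Lemma wedge11_word a b c d :
  wedge11 (lact a (dfun Ou b)) (lact c (dfun Ou d))
    = wprod (add0n 2) (Defs.incl Ou a)
        (wprod (add1n 1) (dfun Ou (b * c)) (dfun Ou d))
      - wprod (add0n 2) (Defs.incl Ou (a * b))
          (wprod (add1n 1) (dfun Ou c) (dfun Ou d)) :> forms Ou 2.
Proof.
have [_ _ iM] := incl_morphism Ou.
rewrite /wedge11 /lact /= /flact (wprodA _ _ (add1n 1) (add0n 2)).
rewrite -(wprodA (addn0 1) (add1n 1)) iM (wprodA _ _ (add0n 2) (add0n 2)).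
have -> : wprod (addn0 1) (dfun Ou b) (Defs.incl Ou c)
    = dfun Ou (b * c) - lact b (dfun Ou c) by rewrite dfunM addrK.
rewrite wprodDl wprodDr; congr (_ + _).
rewrite -[- lact _ _]scaleN1r wprodZl wprodZr scaleN1r.
by rewrite (wprodA (add0n 1) (add1n 1) (add1n 1) (add0n 2)).
Qed.

Lemma repr_mx1 (w : forms Ou 1) : exists M, repr_mx w M.
Proof.
elim/form1_ind: w => [x y [M hM] [N hN]|a b].
  by exists (M + N); apply: repr_mxD.
by exists (a *: gamma_comm b); apply: repr_mx_word1.
Qed.

(** By additivity and uniqueness of the matrices, it suffices to treat words; there [gamma_comm]
    obeys the same Leibniz rule as [dfun]. *)
Lemma repr_mx_wedge (w w' : forms Ou 1) M N : repr_mx w M -> repr_mx w' N ->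
  repr_mx (wedge11 w w' : forms Ou 2) (M *m N).
Proof.
elim/form1_ind: w M => [x y IHx IHy|a b] M hM hN.
  have [[M1 h1] [M2 h2]] := (repr_mx1 x, repr_mx1 y).
  rewrite (repr_mx_uniq hM (repr_mxD h1 h2)) mulmxDl /wedge11 wprodDl.
  by apply: repr_mxD; [apply: IHx|apply: IHy].
rewrite (repr_mx_uniq hM (repr_mx_word1 a b)).
elim/form1_ind: w' N hN => [x y IHx IHy|c d] N hN.
  have [[M1 h1] [M2 h2]] := (repr_mx1 x, repr_mx1 y).
  rewrite (repr_mx_uniq hN (repr_mxD h1 h2)) mulmxDr /wedge11 wprodDr.
  by apply: repr_mxD; [apply: IHx|apply: IHy].
rewrite (repr_mx_uniq hN (repr_mx_word1 c d)) wedge11_word.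
have -> : a *: gamma_comm b *m (c *: gamma_comm d)
  = a *: (gamma_comm (b * c) *m gamma_comm d)
    - (a * b) *: (gamma_comm c *m gamma_comm d).
  rewrite gamma_commM mulmxDl scalerDr -!scalemxAl scalerA addrK.
  by rewrite -mulmxA mul_scalar_mx.
by apply: repr_mxB; apply: repr_mx_word2.
Qed.

Lemma repr_mx_lact a (w : forms Ou 1) M : repr_mx w M -> repr_mx (lact a w) (a *: M).
Proof.
elim/form1_ind: w M => [x y IHx IHy|b c] M hM.
  have [[M1 h1] [M2 h2]] := (repr_mx1 x, repr_mx1 y).
  rewrite (repr_mx_uniq hM (repr_mxD h1 h2)) scalerDr lactDr.
  by apply: repr_mxD; [apply: IHx|apply: IHy].
rewrite (repr_mx_uniq hM (repr_mx_word1 b c)) scalerA -lactM.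
exact: repr_mx_word1.
Qed.

Lemma repr_mx_ract a (w : forms Ou 1) M : repr_mx w M -> repr_mx (ract w a) (M *m a%:M).
Proof.
elim/form1_ind: w M => [x y IHx IHy|b c] M hM.
  have [[M1 h1] [M2 h2]] := (repr_mx1 x, repr_mx1 y).
  rewrite (repr_mx_uniq hM (repr_mxD h1 h2)) mulmxDl ractDl.
  by apply: repr_mxD; [apply: IHx|apply: IHy].
rewrite (repr_mx_uniq hM (repr_mx_word1 b c)).
have -> : ract (lact b (dfun Ou c)) a
  = lact b (dfun Ou (c * a)) - lact (b * c) (dfun Ou a).
  by rewrite dfunM lactDr lactM lractA addrK.
have -> : b *: gamma_comm c *m a%:M = b *: gamma_comm (c * a) - (b * c) *: gamma_comm a.
  by rewrite gamma_commM scalerDr scalerA addrK scalemxAl.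
by apply: repr_mxB; apply: repr_mx_word1.
Qed.

(** For a word [a d b], the product [der i a * der j b] equals [der i (a * der j b) - a * der i (der
    j b)], and the last term is symmetric in [i] and [j] by [der_comm]. Thus when [Pi w] vanishes so
    does [c], and only a symmetric array is left in [dform w]. *)
Lemma repr_mx_dform (w : forms Ou 1) : exists (c : 'I_2 -> sA) (t : 'I_2 -> 'I_2 -> sA),
  [/\ t 0 1 = t 1 0, repr_mx w (\sum_(i < 2) c i *: G i) &
     repr_mx (dform w)
       (\sum_(i < 2) \sum_(j < 2) (der i (c j) - t i j) *: (G i *m G j))].
Proof.
elim/form1_ind: w => [x y [c [t [tE hc ht]]] [c' [t' [tE' hc' ht']]]|a b].
  exists (fun i => c i + c' i), (fun i j => t i j + t' i j); split.
  - by rewrite tE tE'.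
  - have := repr_mxD hc hc'; rewrite -big_split /=.
    by under eq_bigr do rewrite -scalerDl.
  - rewrite /dform; have hl := dga_d_linear (d := Ou) (n := 1).
    rewrite -[x]scale1r hl scale1r.
    suff -> : \sum_(i < 2) \sum_(j < 2)
        (der i (c j + c' j) - (t i j + t' i j)) *: (G i *m G j)
      = \sum_(i < 2) \sum_(j < 2) (der i (c j) - t i j) *: (G i *m G j)
        + \sum_(i < 2) \sum_(j < 2) (der i (c' j) - t' i j) *: (G i *m G j).
      exact: (repr_mxD ht ht').
    rewrite -big_split; apply: eq_bigr => i _; rewrite /= -big_split.
    by apply: eq_bigr => j _; rewrite /= -scalerDl derD opprD addrACA.
exists (fun i => a * der i b), (fun i j => a * der i (der j b)); split.
- by rewrite der_comm.
- have := repr_mx_word1 a b; rewrite /gamma_comm scaler_sumr.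
  by under eq_bigr do rewrite scalerA.
- have -> : \sum_(i < 2) \sum_(j < 2)
      (der i (a * der j b) - a * der i (der j b)) *: (G i *m G j)
    = 1 *: (gamma_comm a *m gamma_comm b).
    rewrite scale1r {1}/gamma_comm mulmx_suml; apply: eq_bigr => i _.
    rewrite /gamma_comm mulmx_sumr; apply: eq_bigr => j _.
    by rewrite derM addrK -[RHS]scalemxAl alg_mx_scale scalerA.
  (* As [d] squares to zero, [d (a d b) = d a d b]; the leading coefficient 1 makes it a word. *)
  suff -> : dform (lact a (dfun Ou b)) = wprod (add0n 2) (Defs.incl Ou 1)
      (wprod (add1n 1) (dfun Ou a) (dfun Ou b)) :> forms Ou 2.
    exact: repr_mx_word2.
  rewrite incl1 wprod1l /dform /lact /= /flact.
  rewrite (dga_d_wprod _ (add1n 1) (add0n 2)) expr0 scale1r dga_d_d.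
  rewrite (_ : wprod (add0n 2) _ 0 = 0) ?addr0 //.
  by apply: (additive0 (f := wprod (add0n 2) _)) => *; rewrite wprodDr.
Qed.

(** * The quotient calculus and its canonical basis *)

Variables (O : calculus sA) (q : forall n, Ou n -> O n).
Hypothesis hO : connes_calculus Pi q.
Variable (e : 'I_2 -> forms O 1).
Hypothesis he : canonical_basis gam emb Pi q e.

Lemma Pi0 n v : Pi (0 : forms Ou n) v = 0.
Proof.
have [_ h _] := hPi.
apply: (additive0 (f := fun w : forms Ou n => Pi w v)) => x y.
by rewrite -[x]scale1r h !scale1r.
Qed.

Lemma quoD n (x y : forms Ou n) : q (x + y) = q x + q y :> forms O n.
Proof. by have [[h _ _ _] _ _ _ _] := hO; rewrite -[x]scale1r h !scale1r. Qed.

Lemma quoB n (x y : forms Ou n) : q (x - y) = q x - q y :> forms O n.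
Proof. by rewrite quoD (additiveN (@quoD n)). Qed.

Lemma quo_lact a n (w : forms Ou n) : q (lact a w) = lact a (q w : forms O n).
Proof.
have [[_ _ h _] h0 _ _ _] := hO.
by rewrite /lact /= /flact h h0.
Qed.

Lemma quo_ract a n (w : forms Ou n) : q (ract w a) = ract (q w : forms O n) a.
Proof.
have [[_ _ h _] h0 _ _ _] := hO.
by rewrite /ract /= /fract h h0.
Qed.

Lemma quo_dfun a : q (dfun Ou a) = dfun O a.
Proof. by have [[_ _ _ h] h0 _ _ _] := hO; rewrite /dfun h h0. Qed.

Lemma quo_wedge (w w' : forms Ou 1) :
  q (wedge11 w w') = wedge11 (q w : forms O 1) (q w') :> forms O 2.
Proof. by have [[_ _ h _] _ _ _ _] := hO; apply: h. Qed.

(** [Pi] is injective in degree zero, so nothing beyond its kernel is divided out in degree one.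
    Conversely, an operator vanishing on the dense subspace is zero by continuity. *)
Lemma quo1_eq0 (w : forms Ou 1) : q w = 0 <-> repr_mx w 0.
Proof.
have [_ _ _ _ /(_ 0%N w) qE] := hO; have [hl _ _] := hPi.
have incl0 : Defs.incl Ou 0 = 0 by exact: (additive0 (@inclD _ _ Ou)).
have d0 : dga_d (0 : Ou 0%N) = 0 :> forms Ou 1.
  apply: (additive0 (f := @dga_d _ Ou 0)) => x y.
  by rewrite -[x]scale1r dga_d_linear !scale1r.
split=> [/qE[j j0 jw] xi|hw].
  have [a aE] := form0_incl j; move: j0 jw; rewrite aE => j0 jw.
  have a0 : repr_mx (Defs.incl Ou a : forms Ou 0) 0.
    by move=> zeta; rewrite mul0mx (additive0 emb2D); apply: j0.
  have /matrixP/(_ 0 0) := repr_mx_uniq a0 (repr_mx0 a).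
  rewrite !mxE eqxx mulr1n => aE0.
  by rewrite mul0mx (additive0 emb2D) jw -aE0 incl0 d0 Pi0.
apply/qE; exists (0 : forms Ou 0) => v; first exact: Pi0.
rewrite d0 Pi0; have [fl fc] := hl _ w.
apply: emb2_dense fl fc _ v => xi.
by rewrite hw mul0mx (additive0 emb2D).
Qed.

Lemma basis_lift i : exists2 w : forms Ou 1, q w = e i & repr_mx w (G i).
Proof. exact: he. Qed.

(** Both products lift to forms with matrix [a *: G i], because the entries of [G i] are scalars. *)
Lemma basis_central i : bimod_central (e i).
Proof.
move=> a; have [w <- hw] := basis_lift i.
apply/eqP; rewrite -subr_eq0 -quo_lact -quo_ract -quoB; apply/eqP/quo1_eq0.
rewrite -(subrr (a *: G i)) -{2}(alg_mx_scalar (gam i) a).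
by apply: repr_mxB; [apply: repr_mx_lact|apply: repr_mx_ract].
Qed.

Lemma basis_free (a : 'I_2 -> sA) :
  \sum_(i < 2) ract (e i) (a i) = 0 -> forall i, a i = 0.
Proof.
rewrite sum_ord2; have [w0 <- h0] := basis_lift 0; have [w1 <- h1] := basis_lift 1.
rewrite -!quo_ract -quoD => /quo1_eq0 h; apply: clifford_free; rewrite sum_ord2.
rewrite -!alg_mx_scalar; apply: (repr_mx_uniq _ h).
exact: repr_mxD (repr_mx_ract _ h0) (repr_mx_ract _ h1).
Qed.

Lemma basis_dfun a : dfun O a = \sum_(i < 2) ract (e i) (der i a).
Proof.
rewrite sum_ord2; have [w0 <- h0] := basis_lift 0; have [w1 <- h1] := basis_lift 1.
apply/eqP; rewrite -subr_eq0 -!quo_ract -quoD -quo_dfun -quoB; apply/eqP/quo1_eq0.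
rewrite -(subrr (gamma_comm a)) {2}/gamma_comm sum_ord2 -!alg_mx_scalar.
apply: repr_mxB (repr_mxD (repr_mx_ract _ h0) (repr_mx_ract _ h1)).
by rewrite -[dfun Ou a]lact1 -[gamma_comm a]scale1r; apply: repr_mx_word1.
Qed.

(** A lift of the form has matrix [a *: (G 0 *m G 1)]. If its class vanishes, this is the matrix of
    some [d j] with [Pi j = 0], hence scalar, and [clifford_scalar_free] applies. *)
Lemma basis_wedge_free a : ract (wedge11 (e 0) (e 1)) a = 0 -> a = 0.
Proof.
have [w0 <- h0] := basis_lift 0; have [w1 <- h1] := basis_lift 1.
have [_ _ _ _ /(_ 1%N) qE] := hO.
rewrite -wedge11_ract -quo_ract -quo_wedge => /qE[j j0 jw].
have [c [t [tE hc ht]]] := repr_mx_dform j.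
have c0 : forall i, c i = 0.
  apply: clifford_free; apply: (repr_mx_uniq hc) => xi.
  by rewrite mul0mx (additive0 emb2D).
have hj : repr_mx (wedge11 w0 (ract w1 a) : forms Ou 2)
   (\sum_(i < 2) \sum_(j < 2) (der i (c j) - t i j) *: (G i *m G j)).
  by move=> xi; rewrite jw; apply: ht.
have := repr_mx_uniq hj (repr_mx_wedge h0 (repr_mx_ract a h1)).
have der0 i : der i 0 = 0 by apply: additive0 (derD i).
rewrite (clifford_sym alg_clifford_sq alg_clifford_anti) ?c0 ?der0 ?tE //.
rewrite alg_mx_scalar alg_mx_scale => h.
have ha : (0 - t 0 0 + (0 - t 1 1))%:M + (- a) *: (G 0 *m G 1) = 0.
  by rewrite h scaleNr subrr.
have [_ /eqP] := clifford_scalar_free ha.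
by rewrite oppr_eq0 => /eqP.
Qed.

(** A coefficient exists, so [xget] returns one rather than its default 0; freeness forces it to be
    [a]. *)
Lemma form_integralE (t : sA -> C) a :
  form_integral e t (ract (wedge11 (e 0) (e 1)) a) = t a.
Proof.
rewrite /form_integral; congr t.
have := xgetPex 0 (ex_intro (fun b => ract (wedge11 (e 0) (e 1)) a
  = ract (wedge11 (e 0) (e 1)) b) a erefl).
move/esym/eqP; rewrite -subr_eq0 -ractNr -ractDr => /eqP/basis_wedge_free/eqP.
by rewrite subr_eq0 => /eqP.
Qed.

Lemma defo_mulVr (k : deformation_parameter U) : defo_inv k * k = 1.
Proof. by case: k. Qed.

(** * Closedness of the basis and the integrated curvature *)

Section Psym.
Notation TT := (tensor (forms O 1) (forms O 1)).
Variables (P : TT -> TT) (hP : is_Psym P).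

(** Writing [e i] as [d U_i] times the adjoint of [U_i], its differential is minus the wedge of
    [d U_i] with the differential of that adjoint. Both factors are multiples of the central form
    [e i], whose wedge square is zero. *)
Lemma basis_dform i : dform (e i) = 0.
Proof.
have [_ _ dU dUs] := hder; have [hrel _ _] := hU.
have dfU : dfun O (torus_gen U i) = ract (e i) (torus_gen U i).
  rewrite basis_dfun sum_ord2 !dU; move: i; apply: ord2_ind.
    by rewrite scale0r scale1r ract0 addr0.
  by rewrite scale0r scale1r ract0 add0r.
have dfUs : dfun O (torus_genstar U i) = - ract (e i) (torus_genstar U i).
  rewrite basis_dfun sum_ord2 !dUs; move: i {dfU}; apply: ord2_ind.
    by rewrite scale0r scale1r oppr0 ract0 addr0 ractNr.
  by rewrite scale0r scale1r oppr0 ract0 add0r ractNr.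
have -> : e i = ract (dfun O (torus_gen U i)) (torus_genstar U i).
  by rewrite dfU -ractM (gen_genstar hrel) ract1.
rewrite /dform /ract /= /fract (dga_d_wprod _ (addn0 2) (erefl : (1 + 1 = 2)%N)).
rewrite expr1 scaleN1r dga_d_d.
have -> : wprod (addn0 2) (0 : O 2) (Defs.incl O (torus_genstar U i)) = 0.
  exact: (@ract0l _ _ (forms O 2)).
rewrite add0r -/(dfun O _) -/(dfun O _) -/(wedge11 _ _) dfUs dfU.
rewrite -(basis_central i (torus_gen U i)) wedge11_lact -ractNr wedge11_ract.
by rewrite (wedge11_centralxx hP (basis_central i)) ract0l lact0r oppr0.
Qed.

Lemma curvature_integralE (t : sA -> C) (k : deformation_parameter U) g nabla Gam :
  is_metric P g -> diag_metric e k g -> levi_civita P g nabla ->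
  christoffel e nabla Gam ->
  let f := 2%:R^-1 *: (defo_inv k * der 1 k) in
  form_integral e t (curvature12 e der Gam) = t (f * f - der 1 f).
Proof.
move=> hg hd hn hG f.
rewrite -(form_integralE t); congr (form_integral e t _).
apply: (curvature12E hP basis_central basis_free basis_dform basis_dfun
  basis_wedge_free (defo_mulVr k) hg hd hn hG).
exact: derD.
Qed.

End Psym.
End Torus.

Theorem proposition5p15 (R : realType) (theta : R)
    (A : cstarType R) (U : 'I_2 -> A) (hU : nc_torus theta U)
    (der : 'I_2 -> torus_alg U -> torus_alg U) (hder : canonical_derivations der)
    (tau : A -> R[i]) (htau : canonical_trace U tau)
    (tau0 : A -> R[i]) (htau0 : faithful_state tau0)
    (H : completeNormedModType R[i]) (emb : A -> H) (hH : is_L2 tau0 emb)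
    (gam : 'I_2 -> 'M[R[i]]_2) (hgam : clifford gam)
    (Ou : calculus (torus_alg U)) (hOu : universal_calculus Ou)
    (Pi : forall n, Ou n -> (H * H)%type -> (H * H)%type)
    (hPi : is_Pi der gam emb Pi)
    (O : calculus (torus_alg U)) (q : forall n, Ou n -> O n)
    (hO : connes_calculus Pi q)
    (e : 'I_2 -> forms O 1) (he : canonical_basis gam emb Pi q e)
    (P : tensor (forms O 1) (forms O 1) -> tensor (forms O 1) (forms O 1))
    (hP : is_Psym P) :
  let curvature_integral (k : deformation_parameter U) (v : R[i]) :=
    forall (g : tensor (forms O 1) (forms O 1) -> torus_alg U)
      (nabla : forms O 1 -> tensor (forms O 1) (forms O 1))
      (Gam : 'I_2 -> 'I_2 -> 'I_2 -> torus_alg U),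
    is_metric P g -> strongly_compatible g -> diag_metric e k g ->
    levi_civita P g nabla -> christoffel e nabla Gam ->
    form_integral e (fun a : torus_alg U => tau (val a)) (curvature12 e der Gam)
      = v in
  forall k1 k2 : deformation_parameter U,
    val (k1 : torus_alg U) = U 0 -> val (k2 : torus_alg U) = U 1 ->
  curvature_integral k1 0 /\ curvature_integral k2 (1 / 4%:R).
Proof.
move=> curvature_integral k1 k2 k1E k2E.
have [[taul _ tau1 _] _ _] := htau.
have tau_0 : tau 0 = 0.
  by apply: (additive0 (f := tau)) => x y; rewrite -[x]scale1r taul !scale1r mul1r.
have tauZ c : tau (c *: 1) = c.
  by rewrite -[c *: 1]addr0 taul tau1 tau_0 mulr1 addr0.
(* If the logarithmic derivative is the constant [c], then [f = c / 2] is killed by [der 1], and the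
   trace is normalized. *)
have key (k : deformation_parameter U) c : defo_inv k * der 1 k = c *: 1 ->
    curvature_integral k (c ^+ 2 / 4%:R).
  move=> kc g nabla Gam hg _ hd hn hG.
  rewrite (curvature_integralE hder hU htau0 hH hgam hPi hO he hP _ hg hd hn hG).
  rewrite kc scalerA (derZ hder) (der1 hder) scaler0 subr0.
  rewrite -scalerAl -scalerAr mulr1 scalerA -expr2 exprMn exprVn -natrX mulrC.
  exact: tauZ.
(* Each generator is an eigenvector of [der 1]: the constant is 0 for [U 0] and 1 for [U 1]. *)
have gen_der (k : deformation_parameter U) i : val (k : torus_alg U) = U i ->
    defo_inv k * der 1 k = (1 == i)%:R *: 1.
  have [_ _ dU _] := hder => ki.
  have -> : der 1 k = (1 == i)%:R *: (k : torus_alg U).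
    have -> : (k : torus_alg U) = torus_gen U i by apply: val_inj.
    by rewrite dU; case: eqP => [->|] //; rewrite !scale0r.
  by rewrite -scalerAr defo_mulVr.
split.
  by have := key _ _ (gen_der _ _ k1E); rewrite expr0n mul0r.
by have := key _ _ (gen_der _ _ k2E); rewrite expr1n.
Qed.
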